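(* Assume that $\mathbb{E}[\omega(0)^2]<\infty$. In addition, if $d=2$, suppose that the law of $\omega(0)$ has strictly positive support. Then there exists a constant $0<C<\infty$ such that for all sufficiently large $x\in\mathbb{Z}^d$ (i.e. all $x\in\mathbb{Z}^d$ with $\|x\|_1$ large enough) and for all $t\ge 0$, $$\mathbb{P}\bigl(a(0,x)-\mathbb{E}[a(0,x)]\le -t\|x\|_1^{1/2}\bigr)\le e^{-Ct^2}.$$
   Context: Let $d\ge 2$ and let $(S_k)_{k\ge0}$ be the simple random walk on $\mathbb{Z}^d$; $P^x$ and $E^x$ denote its law and expectation when started at $x$. Let $\Omega=[0,\infty)^{\mathbb{Z}^d}$ with the canonical $\sigma$-field and let $\mathbb{P}$ be a product probability measure on $\Omega$ under which the coordinates $\omega(x)$, $x\in\mathbb{Z}^d$, of $\omega\in\Omega$ (the potential) are i.i.d.; $\mathbb{E}$ is the expectation under $\mathbb{P}$. It is assumed throughout that $\omega(0)$ is not almost surely equal to $0$. ''The law of $\omega(0)$ has strictly positive support'' means that its (closed) support is contained in $(0,\infty)$. For $y\in\mathbb{Z}^d$ let $H(y)=\inf\{k\ge0: S_k=y\}$. For $x,y\in\mathbb{Z}^d$ set $$e(x,y)=e(x,y,\omega)=E^x\Bigl[\exp\Bigl\{-\sum_{k=0}^{H(y)-1}\omega(S_k)\Bigr\}\mathbf{1}_{\{H(y)<\infty\}}\Bigr]$$ (with $e(x,x)=1$), and define the travel cost $a(x,y)=a(x,y,\omega)=-\log e(x,y,\omega)$. $\|\cdot\|_1$ is the $\ell^1$-norm.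 *)

(* Defs.v *)
From HB Require Import structures.
From mathcomp Require Import all_boot all_order all_algebra.
From mathcomp Require Import all_classical all_reals all_analysis.

Set Implicit Arguments.
Unset Strict Implicit.
Unset Printing Implicit Defensive.

Import Order.TTheory GRing.Theory Num.Theory.
Import numFieldNormedType.Exports.

Local Open Scope classical_set_scope.
Local Open Scope ring_scope.

Notation site d := ('rV[int]_d).

Definition l1norm (d : nat) (x : site d) : nat := (\sum_(i < d) `|x ord0 i|)%N.

Definition srw_step (R : realType) (d : nat) (x y : site d) : R :=
  if l1norm (y - x) == 1%N then (2 * d)%:R^-1 else 0.

(* Under P x, the process S is a Markov chain started at x with transition
   probabilities srw_step, stated through its finite-dimensional laws. *)
Definition simple_random_walk (R : realType) (d : nat) (dW : measure_display)
    (W : measurableType dW) (S : nat -> W -> site d)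
    (P : site d -> probability W R) : Prop :=
  (forall k y, measurable [set v | S k v = y]) /\
  (forall x n (s : nat -> site d),
     P x [set v | forall k, (k <= n)%N -> S k v = s k] =
     ((s 0%N == x)%:R * \prod_(k < n) srw_step R (s k) (s k.+1))%:E).

(* None stands for an infinite hitting time. *)
Definition hitting_time (d : nat) (s : nat -> site d) (y : site d)
    : option nat :=
  match pselect (exists k, s k == y) with
  | left hits => Some (ex_minn hits)
  | right _ => None
  end.

(* The space [0, oo)^(Z^d), not yet carrying its sigma-algebra. *)
Definition potentials (R : realType) (d : nat) : Type := site d -> {nonneg R}.

HB.instance Definition _ (R : realType) (d : nat) :=
  Choice.copy (potentials R d) (site d -> {nonneg R}).
HB.instance Definition _ (R : realType) (d : nat) :=
  isPointed.Build (potentials R d) (fun=> 0%:nng).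

Definition coordinate_events (R : realType) (d : nat)
    : set (set (potentials R d)) :=
  [set A | exists (z : site d) (B : set R),
     measurable B /\ A = [set w | B (w z)%:num]].

Notation Omega R d := (g_sigma_algebraType (@coordinate_events R d)).

Definition coordinate (R : realType) (d : nat) (z : site d) (w : Omega R d)
    : R := (w z)%:num.

Definition coordinate_law (R : realType) (d : nat)
    (P : probability (Omega R d) R) (z : site d) : set R -> \bar R :=
  pushforward P (@coordinate R d z).

Definition iid_coordinates (R : realType) (d : nat)
    (P : probability (Omega R d) R) : Prop :=
  (forall (s : seq (site d)) (B : site d -> set R),
     uniq s -> (forall z, measurable (B z)) ->
     P [set w | forall z, z \in s -> B z (coordinate z w)] =
     (\prod_(z <- s) coordinate_law P z (B z))%E) /\
  (forall (z : site d) (B : set R),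
     measurable B -> coordinate_law P z B = coordinate_law P 0 B).

Definition closed_support (R : realType) (mu : set R -> \bar R) : set R :=
  [set r | forall U : set R, open U -> U r -> (0 < mu U)%E].

Section TravelCost.
Context (R : realType) (d : nat) (dW : measure_display) (W : measurableType dW).
Variables (S : nat -> W -> site d) (Pw : site d -> probability W R).

Definition killing_weight (w : Omega R d) (y : site d) (s : nat -> site d)
    : R :=
  if hitting_time s y is Some n
  then expR (- \sum_(0 <= k < n) coordinate (s k) w) else 0.

Definition travel_e (w : Omega R d) (x y : site d) : \bar R :=
  ('E_(Pw x) [fun v => killing_weight w y (fun k => S k v)])%E.

(* lne is the extended logarithm, with lne 0 = -oo. *)
Definition travel_cost (w : Omega R d) (x y : site d) : \bar R :=
  (- lne (travel_e w x y))%E.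

End TravelCost.

(* Main.v *)
Require Import Defs.
From HB Require Import structures.
From mathcomp Require Import all_boot all_order all_algebra.
From mathcomp Require Import all_classical all_reals all_analysis.
From mathcomp Require Import measurable_realfun ring lra zify.

Set Implicit Arguments.
Unset Strict Implicit.
Unset Printing Implicit Defensive.

Import Order.TTheory GRing.Theory Num.Theory.
Import numFieldNormedType.Exports.

Local Open Scope classical_set_scope.
Local Open Scope ring_scope.

(** For the lower tail, the entropy method only asks by how much the cost can
    rise when the potential at one site [z] is replaced by an independent
    value [r].  The rise is at most [r] times the mean number of visits to [z]
    under the path measure weighted by the original potential ([cost_change]),
    so a second moment of the potential suffices for a Gaussian bound.

    Let [q z] be the probability that the weighted path visits [z].  The mean
    number of visits is at most [q z / kappa]: each return to [z] has weight
    at most [1 - kappa], either because the potential is bounded below ([d = 2])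
    or because the walk is transient ([d >= 3], [transience], proved with an
    explicit superharmonic function).  Tensorization of entropy then gives, for
    [Y = expR (- mu * a)] and [a] the cost,
      [Ent Y <= const * mu ^ 2 * E (Y * \sum_z q z ^ 2)],
    and [\sum_z q z ^ 2 <= \sum_z q z] is the mean number of distinct sites of
    the weighted path.  That number is compared with the cost through
    exponential moments ([sum_visit_prob_le]): if [Z] is the weight of the
    paths with an extra factor [expR c] for each distinct site, Jensen's
    inequality gives [c * \sum_z q z <= a + ln Z], and [E Z <= 1] when
    [E (expR (c - omega 0)) <= 1], since distinct sites carry independent
    potentials ([resample_range_weight_le]).  By the variational formula
    [E (Y * ln Z) <= Ent Y], which is absorbed for small [mu].  Hence
    [Ent Y <= const * mu ^ 2 * |x|_1 * E Y], and Herbst's argument ([herbst])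
    with Chernoff's bound ends the proof.  Small values of [mu] cover every
    possible deviation, because the cost is nonnegative with mean of order
    [|x|_1].

    This is carried out for the walk killed after [n] steps and for a potential
    rounded to finitely many values, where all expectations are finite sums
    ([cost_log_laplace]).  The path expectations are functions of the starting
    point defined by first-step recursion, so that each inequality between
    them is an induction on [n].  Fatou's lemma removes first the rounding and
    then the horizon [n]; the recursion is tied to the random walk of the
    statement by integrating over cylinder events ([travel_e_cvg]). *)

(** * Entropy and the Herbst argument for an abstract expectation *)

Section Expectation.
Context (R : realType) (X : Type).

(** The entropy inequalities need of the product law only these five rules. *)
Record is_expectation (E : (X -> R) -> R) : Prop := Expectation {
  exp_gt0 : forall F, (forall x, 0 < F x) -> 0 < E F;
  exp_le : forall F G, (forall x, F x <= G x) -> E F <= E G;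
  expD : forall F G, E (fun x => F x + G x) = E F + E G;
  expZ : forall c F, E (fun x => c * F x) = c * E F;
  exp1 : E (fun=> 1) = 1 }.

Definition entropy (E : (X -> R) -> R) (Y : X -> R) : R :=
  E (fun x => Y x * ln (Y x)) - E Y * ln (E Y).

Context (E : (X -> R) -> R) (HE : is_expectation E).

Lemma exp_cst c : E (fun=> c) = c.
Proof.
by rewrite -[RHS]mulr1 -(exp1 HE) -(expZ HE); congr E; apply/funext => x;
  rewrite mulr1.
Qed.

Lemma exp_eq F G : (forall x, F x = G x) -> E F = E G.
Proof. by move=> /funext ->. Qed.

Lemma expZr c F : E (fun x => F x * c) = E F * c.
Proof. by rewrite mulrC -(expZ HE); apply: exp_eq => x; rewrite mulrC. Qed.

Lemma expB F G : E (fun x => F x - G x) = E F - E G.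
Proof.
rewrite -[- E G]mulN1r -(expZ HE) -(expD HE).
by apply: exp_eq => x; rewrite mulN1r.
Qed.

Lemma exp_sum (J : Type) (s : seq J) (F : J -> X -> R) :
  E (fun x => \sum_(j <- s) F j x) = \sum_(j <- s) E (F j).
Proof.
elim: s => [|j s IHs].
  by rewrite big_nil -[RHS](exp_cst 0); apply: exp_eq => x; rewrite big_nil.
rewrite big_cons -IHs -(expD HE); apply: exp_eq => x.
by rewrite big_cons.
Qed.

Lemma ln_le_sub1 (y : R) : 0 < y -> ln y <= y - 1.
Proof. by move=> y0; have := @le_ln1Dx R (y - 1); rewrite (_ : 1 + (y - 1) = y); [apply; lra|ring]. Qed.

(** Half of the variational formula of entropy.  Pointwise it is
    [ln y <= y - 1] at [y = V x * E Y / Y x]. *)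
Lemma entropy_variational (Y V : X -> R) :
  (forall x, 0 < Y x) -> (forall x, 0 < V x) -> E V <= 1 ->
  E (fun x => Y x * ln (V x)) <= entropy E Y.
Proof.
move=> Y0 V0 V1; have EY0 := exp_gt0 HE Y0.
have key x : Y x * ln (V x) <=
    Y x * ln (Y x) - Y x * ln (E Y) + (V x * E Y - Y x).
  have := @ln_le_sub1 (V x * E Y / Y x) (divr_gt0 (mulr_gt0 (V0 x) EY0) (Y0 x)).
  rewrite ln_div ?lnM ?posrE ?mulr_gt0// => /(ler_wpM2l (ltW (Y0 x))).
  rewrite [X in _ <= X -> _]mulrBr mulrCA divff ?gt_eqF// ?mulr1; lra.
apply: (le_trans (exp_le HE key)).
rewrite (expD HE) !expB !expZr /entropy.
have : E V * E Y <= E Y by apply: ler_piMl => //; exact: ltW.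
lra.
Qed.

(** Chebyshev's association inequality: [expR (- mu * a)] decreases with [a],
    so its deviation from its value at [a = E a] has the sign opposite to
    that of [a - E a]. *)
Lemma exp_mul_expR_le (a : X -> R) (mu : R) : 0 <= mu ->
  E (fun x => expR (- mu * a x) * a x) <= E (fun x => expR (- mu * a x)) * E a.
Proof.
move=> mu0; set Y := fun x => expR (- mu * a x); set a0 := E a.
suff : E (fun x => (Y x * a x - Y x * a0) - expR (- mu * a0) * (a x - a0)) <= 0.
  by rewrite expB (expZ HE) !expB expZr exp_cst subrr mulr0 subr0 subr_le0.
rewrite -[leRHS](exp_cst 0); apply: (exp_le HE) => x.
have [ax|ax] := leP (a x) a0.
  have : expR (- mu * a0) <= Y x by rewrite ler_expR !mulNr lerN2 ler_wpM2l.
  nra.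
have : Y x <= expR (- mu * a0) by rewrite ler_expR !mulNr lerN2 ler_wpM2l // ltW.
nra.
Qed.

(** The variational formula at [V = sqrt Y / E (sqrt Y)].  For
    [Y = expR (- mu * a)] it compares the log-Laplace transforms at [mu] and
    [mu / 2], and so replaces the differential inequality of Herbst's argument. *)
Lemma entropy_halving (Y : X -> R) (K : R) : (forall x, 0 < Y x) ->
  entropy E Y <= K * E Y ->
  ln (E Y) <= 2 * ln (E (fun x => expR (ln (Y x) / 2))) + K.
Proof.
move=> Y0 HK; have EY0 := exp_gt0 HE Y0.
set Q := fun x => expR (ln (Y x) / 2).
have Q0 x : 0 < Q x by exact: expR_gt0.
have EQ0 := exp_gt0 HE Q0.
have := @entropy_variational Y (fun x => Q x / E Q) Y0.
move=> /(_ (fun x => divr_gt0 (Q0 x) EQ0)).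
rewrite expZr divff ?gt_eqF// lexx => /(_ isT).
have -> : E (fun x => Y x * ln (Q x / E Q)) =
          E (fun x => Y x * ln (Y x)) / 2 - E Y * ln (E Q).
  rewrite -!expZr -expB; apply: exp_eq => x.
  by rewrite ln_div ?posrE// /Q expRK; field.
move: HK; rewrite /entropy => HK H.
rewrite -(ler_pM2l EY0); nra.
Qed.

Lemma le0_of_dyadic (x B : R) : (forall n, x <= B / 2 ^+ n) -> x <= 0.
Proof.
move=> H; rewrite leNgt; apply/negP => x0.
have B0 : 0 < B by have := H 0%N; rewrite expr0 divr1; lra.
have := H (Num.truncn (B / x)).+1.
rewrite ler_pdivlMr ?exprn_gt0// leNgt => /negP; apply.
rewrite -ltr_pdivrMl//.
have H1 : B / x < (Num.truncn (B / x)).+1%:R by rewrite truncnS_gt.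
rewrite mulrC; apply: (lt_le_trans H1).
by rewrite -natrX ler_nat ltnW// ltn_expl.
Qed.

Lemma expRN_le_quadratic (y : R) : 0 <= y -> expR (- y) <= 1 - y + y ^+ 2.
Proof.
move=> y0; rewrite expRN.
have H : 1 + y <= expR y := expR_ge1Dx y.
have H1 : (expR y)^-1 <= (1 + y)^-1 by rewrite lef_pV2 ?posrE ?expR_gt0//; lra.
apply: (le_trans H1); rewrite -[leLHS]mul1r ler_pdivrMr; nra.
Qed.

(** Halving [mu] repeatedly, the errors [2 ^ j * K * (mu / 2 ^ j) ^ 2] sum to at
    most [2 * K * mu ^ 2], and [2 ^ n * ln (L (mu / 2 ^ n))] tends to
    [- mu * E a]. *)
Lemma herbst (a : X -> R) (K mu0 : R) : 0 <= K -> (forall x, 0 <= a x) ->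
  (forall mu, 0 <= mu <= mu0 ->
    entropy E (fun x => expR (- mu * a x)) <=
      K * mu ^+ 2 * E (fun x => expR (- mu * a x))) ->
  forall mu, 0 <= mu <= mu0 ->
    E (fun x => expR (- mu * a x)) <= expR (- mu * E a + 2 * K * mu ^+ 2).
Proof.
move=> K0 a0 Hent.
pose L mu := E (fun x => expR (- mu * a x)).
have L0 mu : 0 < L mu by apply: (exp_gt0 HE) => x; exact: expR_gt0.
have half mu : 0 <= mu <= mu0 -> ln (L mu) <= 2 * ln (L (mu / 2)) + K * mu ^+ 2.
  move=> hmu.
  have := entropy_halving (fun x => expR_gt0 (- mu * a x)) (Hent _ hmu).
  congr (_ <= _ * ln _ + _); apply: exp_eq => x; rewrite expRK.
  by congr expR; field.
have iter n : forall mu, 0 <= mu <= mu0 ->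
    ln (L mu) <= 2 ^+ n * ln (L (mu / 2 ^+ n)) + 2 * K * mu ^+ 2.
  elim: n => [|n IHn] mu hmu.
    by rewrite expr0 divr1 mul1r lerDl; apply: mulr_ge0; [lra|exact: sqr_ge0].
  have hmu2 : 0 <= mu / 2 <= mu0 by move: hmu; lra.
  have := IHn _ hmu2; have := half _ hmu.
  have -> : mu / 2 / 2 ^+ n = mu / 2 ^+ n.+1 by rewrite exprS invfM mulrA.
  rewrite (exprS 2 n); set l := ln (L (mu / _)); set p := 2 ^+ n.
  have : 0 <= K * mu ^+ 2 by rewrite mulr_ge0 ?sqr_ge0.
  rewrite expr_div_n; nra.
move=> mu hmu; rewrite -[leLHS]lnK ?posrE ?L0// ler_expR -subr_le0.
apply: (@le0_of_dyadic _ (mu ^+ 2 * E (fun x => a x ^+ 2))) => n.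
have := iter n _ hmu; set t := mu / 2 ^+ n => H.
have p0 : 0 < 2 ^+ n :> R by rewrite exprn_gt0.
have t0 : 0 <= t by apply: divr_ge0; [move: hmu; lra|exact: ltW].
have pt : 2 ^+ n * t = mu by rewrite /t mulrC divfK// gt_eqF.
have : ln (L t) <= - t * E a + t ^+ 2 * E (fun x => a x ^+ 2).
  apply: (le_trans (ln_le_sub1 (L0 t))).
  rewrite -(expZ HE) -(expZ HE) -(expD HE) -[X in _ - X](exp_cst 1) -expB.
  apply: (exp_le HE) => x.
  have := @expRN_le_quadratic (t * a x) (mulr_ge0 t0 (a0 x)).
  rewrite mulNr exprMn; lra.
move=> /(ler_wpM2l (ltW p0)).
set A := E a; set B := E _.
have -> : 2 ^+ n * (- t * A + t ^+ 2 * B) =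
          - (2 ^+ n * t) * A + (2 ^+ n * t) * t * B by ring.
rewrite pt (_ : mu * t * B = mu ^+ 2 * B / 2 ^+ n); first by move: H; lra.
by rewrite /t expr2; field; rewrite gt_eqF.
Qed.

End Expectation.

(** * Tensorization of entropy for a finite product law *)

Section Resampling.
Context (R : realType) (T : eqType) (I : finType) (p : I -> R).
Hypotheses (p_ge0 : forall i, 0 <= p i) (p_sum1 : \sum_i p i = 1).

Implicit Types (w : T -> I) (F G Y : (T -> I) -> R) (s : seq T) (z : T).

Definition update w z i : T -> I := fun y => if y == z then i else w y.

Definition resample z F w : R := \sum_i p i * F (update w z i).

(** The expectation under the product law of the coordinates in [s], with the
    other coordinates frozen. *)
Fixpoint resample_seq s F : (T -> I) -> R :=
  if s is z :: s' then resample z (resample_seq s' F) else F.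

Definition free_of F z := forall w i, F (update w z i) = F w.

Lemma update_same w z i : update w z i z = i.
Proof. by rewrite /update eqxx. Qed.

Lemma update_other w z i y : y != z -> update w z i y = w y.
Proof. by rewrite /update => /negPf ->. Qed.

Lemma update_update w z i j : update (update w z i) z j = update w z j.
Proof. by apply/funext => y; rewrite /update; case: eqP. Qed.

Lemma update_comm w z z' i j : z != z' ->
  update (update w z i) z' j = update (update w z' j) z i.
Proof.
move=> zz'; apply/funext => y; rewrite /update.
by case: (eqVneq y z') => // ->; rewrite eq_sym (negPf zz').
Qed.

Lemma resample_comm z z' F :
  resample z (resample z' F) = resample z' (resample z F).
Proof.
have [->//|zz'] := eqVneq z z'; apply/funext => w; rewrite /resample.
under eq_bigr do rewrite big_distrr/=.
rewrite exchange_big/=; apply: eq_bigr => j _.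
rewrite big_distrr/=; apply: eq_bigr => i _.
by rewrite update_comm// !mulrA (mulrC (p i)).
Qed.

Lemma resample_seq_comm s z F :
  resample_seq s (resample z F) = resample z (resample_seq s F).
Proof. by elim: s => //= y s ->; rewrite resample_comm. Qed.

Lemma resample_free z F : free_of F z -> resample z F = F.
Proof.
move=> HF; apply/funext => w; rewrite /resample.
by under eq_bigr do rewrite HF; rewrite -mulr_suml p_sum1 mul1r.
Qed.

Lemma free_resample z F : free_of (resample z F) z.
Proof.
by move=> w i; apply: eq_bigr => j _; rewrite update_update.
Qed.

Lemma free_resample_other z y F : free_of F z -> free_of (resample y F) z.
Proof.
have [->|zy] := eqVneq z y; first by move=> _; exact: free_resample.
move=> HF w i; apply: eq_bigr => j _.
by rewrite update_comm// HF.
Qed.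

Lemma free_resample_seq z s F : z \in s -> free_of (resample_seq s F) z.
Proof.
elim: s => // y s IHs; rewrite inE => /orP[/eqP ->|zs]/=.
  exact: free_resample.
exact/free_resample_other/IHs.
Qed.

Lemma resample_seq_absorb s z F : z \in s ->
  resample_seq s (resample z F) = resample_seq s F.
Proof.
by move=> zs; rewrite resample_seq_comm resample_free//; exact: free_resample_seq.
Qed.

Lemma resample_expectation z w : is_expectation (fun F => resample z F w).
Proof.
split.
- move=> F F0; rewrite /resample.
  have : [exists i, p i != 0].
    apply/existsP; apply: contrapT => /forallNP H.
    have : \sum_i p i = 0 :> R.
      by apply: big1 => i _; apply/eqP; have /negP := H i; rewrite negbK.
    by rewrite p_sum1 => /eqP; rewrite oner_eq0.
  move=> /existsP[i pi0]; rewrite (bigD1 i)//= ltr_wpDr//.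
    by apply: sumr_ge0 => j _; rewrite mulr_ge0// ltW.
  by rewrite mulr_gt0// lt_def pi0 p_ge0.
- by move=> F G FG; apply: ler_sum => i _; rewrite ler_wpM2l.
- move=> F G; rewrite /resample -big_split/=.
  by apply: eq_bigr => i _; rewrite mulrDr.
- move=> c F; rewrite /resample big_distrr/=.
  by apply: eq_bigr => i _; rewrite mulrCA.
- by rewrite /resample -mulr_suml p_sum1 mul1r.
Qed.

Lemma resample_seq_expectation s w : is_expectation (fun F => resample_seq s F w).
Proof.
elim: s w => [|z s IHs] w /=; first by split => //.
have Hz := resample_expectation z w; split.
- by move=> F F0; apply: (exp_gt0 Hz) => w'; apply: (exp_gt0 (IHs w')).
- by move=> F G FG; apply: (exp_le Hz) => w'; apply: (exp_le (IHs w')).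
- move=> F G; rewrite -(expD Hz); apply: eq_bigr => i _.
  by rewrite (expD (IHs _)).
- move=> c F; rewrite -(expZ Hz); apply: eq_bigr => i _.
  by rewrite (expZ (IHs _)).
- rewrite -[RHS](exp1 Hz); apply: eq_bigr => i _.
  by rewrite (exp1 (IHs _)).
Qed.

Definition coordinate_entropy z Y w := entropy (fun F => resample z F w) Y.

Lemma free_coordinate_entropy z Y : free_of (coordinate_entropy z Y) z.
Proof.
move=> w i; rewrite /coordinate_entropy /entropy.
by rewrite !free_resample.
Qed.

(** Entropy is convex.  The optimal [V] in the variational formula for
    [resample y Y] is admissible for [Y] at each value of the coordinate [y],
    because its mean over the coordinate [z] stays equal to 1. *)
Lemma coordinate_entropy_resample z y Y w : z != y -> (forall w, 0 < Y w) ->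
  coordinate_entropy z (resample y Y) w <=
  resample y (coordinate_entropy z Y) w.
Proof.
move=> zy Y0; set U := resample y Y.
have U0 w' : 0 < U w' by apply: (exp_gt0 (resample_expectation y w')).
set m := resample z U w.
have m0 : 0 < m by apply: (exp_gt0 (resample_expectation z w)).
have mE j : resample z U (update w y j) = m.
  rewrite /m /U resample_comm; exact: free_resample.
(* The maximiser of the variational formula for the entropy of U. *)
pose V w' := U w' / m.
have V0 w' : 0 < V w' by exact: divr_gt0.
have HE1 := resample_expectation z w.
have -> : coordinate_entropy z U w =
          resample z (fun w' => U w' * ln (V w')) w.
  rewrite /coordinate_entropy /entropy -/m -(expZr HE1) -(expB HE1).
  by congr (resample z _ w); apply/funext => w'; rewrite /V ln_div ?posrE// mulrBr.
have -> : (fun w' => U w' * ln (V w')) = resample y (fun w' => Y w' * ln (V w')).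
  apply/funext => w'; rewrite {1}/U /resample mulr_suml; apply: eq_bigr => j _.
  by rewrite [V (update w' y j)]/V /U free_resample mulrA.
rewrite resample_comm.
apply: ler_sum => j _; apply: ler_wpM2l => //.
apply: (entropy_variational (resample_expectation _ _) Y0 V0).
by rewrite (expZr (resample_expectation _ _)) mE divff// gt_eqF.
Qed.

Lemma coordinate_entropy_resample_seq z s Y w : z \notin s ->
  (forall w, 0 < Y w) ->
  coordinate_entropy z (resample_seq s Y) w <=
  resample_seq s (coordinate_entropy z Y) w.
Proof.
move=> + Y0; elim: s w => //= y s IHs w; rewrite inE negb_or => /andP[zy zs].
apply: (le_trans (coordinate_entropy_resample _ zy _)).
  by move=> w'; apply: (exp_gt0 (resample_seq_expectation s w')).
by apply: (exp_le (resample_expectation y w)) => w'; exact: IHs.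
Qed.

(** Chain rule: integrating one coordinate more adds the entropy, in that
    coordinate, of a partial average of [Y]; convexity takes the average out. *)
Lemma entropy_tensorization s Y w : uniq s -> (forall w, 0 < Y w) ->
  entropy (fun F => resample_seq s F w) Y <=
  \sum_(z <- s) resample_seq s (coordinate_entropy z Y) w.
Proof.
move=> + Y0; elim: s w => [|z s IHs] w /=.
  by rewrite big_nil /entropy subrr.
move=> /andP[zs us]; have HE := resample_expectation z w.
rewrite big_cons.
have -> : resample z (resample_seq s (coordinate_entropy z Y)) w =
          resample_seq s (coordinate_entropy z Y) w.
  rewrite -resample_seq_comm resample_free//; exact: free_coordinate_entropy.
have := coordinate_entropy_resample_seq w zs Y0.
rewrite /coordinate_entropy /entropy -/(coordinate_entropy _ _) => H1.
have : resample z (fun w' => entropy (fun F => resample_seq s F w') Y) w <=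
       \sum_(j <- s) resample z (resample_seq s (coordinate_entropy j Y)) w.
  rewrite -(exp_sum HE); exact: (exp_le HE (fun w' => IHs w' us)).
rewrite /entropy (expB HE).
move: H1; lra.
Qed.

(** By Jensen's inequality the entropy is at most the covariance of [expR f]
    and [f], which is half the mean of [(expR s - expR t) * (s - t)] for two
    independent copies, and [(expR s - expR t) * (s - t)] is at most
    [expR s * (s - t) ^ 2] when [t <= s].  The weight is thus evaluated at
    the copy where [f] is larger. *)
Lemma coordinate_entropy_le z (f : (T -> I) -> R) w :
  coordinate_entropy z (fun w => expR (f w)) w <=
  \sum_i p i * \sum_j p j * (expR (f (update w z i)) *
     Num.max (f (update w z i) - f (update w z j)) 0 ^+ 2).
Proof.
set L := fun i => f (update w z i).
pose D i j := expR (L i) * (L i - L j).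
pose Q i j := expR (L i) * Num.max (L i - L j) 0 ^+ 2.
have HE := resample_expectation z w.
have jensen : \sum_i p i * L i <= ln (\sum_i p i * expR (L i)).
  pose m := \sum_i p i * expR (L i).
  have m0 : 0 < m := exp_gt0 HE (fun w' => expR_gt0 (f w')).
  have key w' : f w' <= expR (f w') / m - 1 + ln m.
    have := ln_le_sub1 (divr_gt0 (expR_gt0 (f w')) m0).
    by rewrite ln_div ?posrE ?expR_gt0// expRK; lra.
  have := exp_le HE key; rewrite (expD HE) (expB HE) (expZr HE) !(exp_cst HE).
  have -> : resample z (fun x => expR (f x)) w = m by [].
  by rewrite divff ?gt_eqF// subrr add0r.
have step1 : coordinate_entropy z (fun w => expR (f w)) w <=
    \sum_i p i * \sum_j p j * D i j.
  rewrite /coordinate_entropy /entropy.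
  have -> : \sum_i p i * \sum_j p j * D i j =
     \sum_i p i * (expR (L i) * L i) -
     (\sum_i p i * expR (L i)) * (\sum_j p j * L j).
    rewrite mulr_suml -sumrB; apply: eq_bigr => i _.
    rewrite -mulrA -mulrBr; congr (_ * _).
    rewrite /D; under eq_bigr do rewrite mulrBr mulrBr.
    rewrite sumrB -mulr_suml p_sum1 mul1r; congr (_ - _).
    by rewrite mulr_sumr; apply: eq_bigr => j _; rewrite mulrCA.
  have -> : resample z (fun x => expR (f x) * ln (expR (f x))) w =
     \sum_i p i * (expR (L i) * L i).
    by apply: eq_bigr => i _; rewrite expRK.
  rewrite lerB// ler_wpM2l//.
  by apply: sumr_ge0 => i _; rewrite mulr_ge0// expR_ge0.
apply: (le_trans step1); rewrite -/(Q _ _).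
have sym (H : I -> I -> R) : \sum_i p i * \sum_j p j * H i j =
    \sum_i p i * \sum_j p j * ((H i j + H j i) / 2).
  have H2 : \sum_i p i * \sum_j p j * H i j = \sum_i p i * \sum_j p j * H j i.
    under eq_bigr do rewrite mulr_sumr.
    rewrite exchange_big/=; apply: eq_bigr => i _; rewrite mulr_sumr.
    by apply: eq_bigr => j _; rewrite mulrCA.
  have -> : \sum_i p i * \sum_j p j * ((H i j + H j i) / 2) =
    (\sum_i p i * \sum_j p j * H i j + \sum_i p i * \sum_j p j * H j i) / 2.
    rewrite -big_split mulr_suml; apply: eq_bigr => i _ /=.
    rewrite -mulrDr -big_split/= -mulrA mulr_suml; congr (_ * _).
    by apply: eq_bigr => j _; field.
  by rewrite -H2; field.
rewrite [leLHS]sym [leRHS](sym Q).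
apply: ler_sum => i _; apply: ler_wpM2l => //.
apply: ler_sum => j _; apply: ler_wpM2l => //.
rewrite ler_pM2r ?invr_gt0//.
have aux (x y : R) : y <= x ->
    expR x * (x - y) + expR y * (y - x) <=
    expR x * Num.max (x - y) 0 ^+ 2 + expR y * Num.max (y - x) 0 ^+ 2.
  move=> yx; rewrite (max_idPl _) ?subr_ge0// (max_idPr _) ?subr_le0//.
  have -> : expR y = expR x * expR (y - x) by rewrite -expRD; congr expR; ring.
  have H1 := expR_gt0 x; have H2 := expR_ge1Dx (y - x).
  have H3 : 0 <= x - y by rewrite subr_ge0.
  rewrite expr0n/= mulr0 addr0.
  have -> : expR x * (x - y) + expR x * expR (y - x) * (y - x) =
     expR x * ((x - y) * (1 - expR (y - x))) by ring.
  rewrite ler_pM2l// expr2 ler_wpM2l//; lra.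
rewrite /D /Q; have [LL|/ltW LL] := leP (L j) (L i); first exact: aux.
rewrite [leLHS]addrC [leRHS]addrC; exact: aux.
Qed.

End Resampling.

(** * Killed walk: path expectations by first-step recursion *)

Section Walk.
Context (R : realType) (d : nat).

Definition direction : Type := ('I_d * bool)%type.
HB.instance Definition _ := Finite.on direction.

Implicit Types (w : site d -> R) (u y z : site d) (n m : nat).

Definition unit_step (i : direction) : site d :=
  (-1) ^+ i.2 *: delta_mx ord0 i.1.

Definition average (f : site d -> R) u : R :=
  (2 * d)%:R^-1 * \sum_(i : direction) f (u + unit_step i).

Lemma card_direction : #|{: direction}| = (2 * d)%N.
Proof. by rewrite card_prod card_ord card_bool mulnC. Qed.

Lemma average_le f g u : (forall y, f y <= g y) -> average f u <= average g u.
Proof.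
by move=> fg; rewrite ler_wpM2l ?invr_ge0 ?ler0n//; apply: ler_sum.
Qed.

Lemma average_ge0 f u : (forall y, 0 <= f y) -> 0 <= average f u.
Proof.
by move=> f0; rewrite mulr_ge0 ?invr_ge0 ?ler0n//; apply: sumr_ge0.
Qed.

Lemma averageD f g u :
  average (fun y => f y + g y) u = average f u + average g u.
Proof. by rewrite /average big_split mulrDr. Qed.

Lemma averageZ c f u : average (fun y => c * f y) u = c * average f u.
Proof. by rewrite /average -mulr_sumr mulrCA. Qed.

Lemma average_sum (J : Type) (s : seq J) (P : pred J) (F : J -> site d -> R) u :
  average (fun y => \sum_(j <- s | P j) F j y) u =
  \sum_(j <- s | P j) average (F j) u.
Proof. by rewrite /average exchange_big mulr_sumr. Qed.

Lemma average_cst c u : (0 < d)%N -> average (fun=> c) u = c.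
Proof.
move=> d0; rewrite /average sumr_const card_direction -[X in _ * X]mulr_natl mulrA mulVf.
  by rewrite mul1r.
by rewrite pnatr_eq0 -lt0n muln_gt0.
Qed.

Context (x : site d).

(** The expectation of [expR (- \sum_(k < H(x)) w (S k))] on [H(x) <= n] for
    the walk started at [u]; the three weights below insert into it the
    indicator that [z] is visited before [x], the number of such visits, and
    a factor [expR c] for each distinct site outside [A] visited before [x]. *)
Fixpoint hit_weight n w u : R :=
  if n is n'.+1 then
    if u == x then 1 else expR (- w u) * average (hit_weight n' w) u
  else (u == x)%:R.

Fixpoint visit_weight z n w u : R :=
  if n is n'.+1 then
    if u == x then 0
    else if u == z then hit_weight n w u
    else expR (- w u) * average (visit_weight z n' w) u
  else 0.

Fixpoint occupation_weight z n w u : R :=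
  if n is n'.+1 then
    if u == x then 0
    else (u == z)%:R * hit_weight n w u +
         expR (- w u) * average (occupation_weight z n' w) u
  else 0.

Fixpoint range_weight (c : R) n w u (A : seq (site d)) : R :=
  if n is n'.+1 then
    if u == x then 1
    else expR (c * (u \notin A)%:R - w u) *
         average (fun y => range_weight c n' w y (u :: A)) u
  else (u == x)%:R.

(** The probability that the walk started at [u] hits [z] within [n] steps. *)
Fixpoint hit_prob z n u : R :=
  if n is n'.+1 then if u == z then 1 else average (hit_prob z n') u
  else (u == z)%:R.

Lemma hit_weightS n w u : hit_weight n.+1 w u =
  if u == x then 1 else expR (- w u) * average (hit_weight n w) u.
Proof. by []. Qed.

Lemma visit_weightS z n w u : visit_weight z n.+1 w u =
  if u == x then 0
  else if u == z then hit_weight n.+1 w u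
  else expR (- w u) * average (visit_weight z n w) u.
Proof. by []. Qed.

Lemma occupation_weightS z n w u : occupation_weight z n.+1 w u =
  if u == x then 0
  else (u == z)%:R * hit_weight n.+1 w u +
       expR (- w u) * average (occupation_weight z n w) u.
Proof. by []. Qed.

Lemma hit_probS z n u : hit_prob z n.+1 u =
  if u == z then 1 else average (hit_prob z n) u.
Proof. by []. Qed.

Lemma range_weightS c n w u A : range_weight c n.+1 w u A =
  if u == x then 1
  else expR (c * (u \notin A)%:R - w u) *
       average (fun y => range_weight c n w y (u :: A)) u.
Proof. by []. Qed.

Lemma hit_weight_ge0 n w u : 0 <= hit_weight n w u.
Proof.
elim: n u => [|n IHn] u /=; first by rewrite ler0n.
by case: ifP => _ //; rewrite mulr_ge0 ?expR_ge0// average_ge0.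
Qed.

Lemma visit_weight_ge0 z n w u : 0 <= visit_weight z n w u.
Proof.
elim: n u => [|n IHn] u //; rewrite visit_weightS.
case: ifP => _ //; case: ifP => _; first exact: hit_weight_ge0.
by rewrite mulr_ge0 ?expR_ge0 ?average_ge0.
Qed.

Lemma occupation_weight_ge0 z n w u : 0 <= occupation_weight z n w u.
Proof.
elim: n u => [|n IHn] u //; rewrite occupation_weightS; case: ifP => _ //.
apply: addr_ge0; first by rewrite mulr_ge0 ?ler0n ?hit_weight_ge0.
by rewrite mulr_ge0 ?expR_ge0// average_ge0.
Qed.

Lemma range_weight_gt0 c n w u A : 0 < hit_weight n w u ->
  0 < range_weight c n w u A.
Proof.
elim: n u A => [|n IHn] u A //=; case: ifP => // _ H.
rewrite mulr_gt0 ?expR_gt0//.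
move: H; rewrite pmulr_rgt0 ?expR_gt0//.
rewrite /average; case: (posnP d) => [d0|d0].
  by rewrite (_ : (2 * d)%:R = 0) ?invr0 ?mul0r ?ltxx// d0.
rewrite !pmulr_rgt0 ?invr_gt0 ?ltr0n ?muln_gt0// => H.
have [i Hi] : exists i, 0 < hit_weight n w (u + unit_step i).
  apply: contrapT => /forallNP H'; move: H; rewrite lt_neqAle => /andP[+ _].
  rewrite eq_sym big1 ?eqxx// => i _; apply/eqP; rewrite eq_le hit_weight_ge0.
  by rewrite andbT leNgt; apply/negP.
rewrite (bigD1 i)//= ltr_wpDr ?IHn//; apply: sumr_ge0 => j _.
elim: n {IHn H Hi} (u + _) (u :: A) => [|n IHn] u' A' /=; first by rewrite ler0n.
by case: ifP => // _; rewrite mulr_ge0 ?expR_ge0// average_ge0.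
Qed.

Lemma hit_weight_nd n w u : hit_weight n w u <= hit_weight n.+1 w u.
Proof.
elim: n u => [|n IHn] u.
  by rewrite /=; case: ifP => _//=; rewrite mulr_ge0 ?expR_ge0// average_ge0.
rewrite !hit_weightS; case: ifP => // _.
by rewrite ler_pM2l ?expR_gt0// average_le.
Qed.

Lemma hit_weight_at n w : hit_weight n w x = 1.
Proof. by case: n => [|n] /=; rewrite eqxx. Qed.

Lemma occupation_weight_nd z n w u :
  occupation_weight z n w u <= occupation_weight z n.+1 w u.
Proof.
elim: n u => [|n IHn] u; first exact: occupation_weight_ge0.
rewrite !occupation_weightS; case: ifP => // _.
apply: lerD; last by rewrite ler_pM2l ?expR_gt0// average_le.
by rewrite ler_wpM2l ?ler0n// hit_weight_nd.
Qed.

Lemma hit_weight_anti n w w' u : (forall y, w y <= w' y) ->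
  hit_weight n w' u <= hit_weight n w u.
Proof.
move=> ww; elim: n u => [|n IHn] u //=; case: ifP => // _.
apply: ler_pM; rewrite ?expR_ge0 ?average_ge0 ?ler_expR ?lerN2//.
  by move=> y; exact: hit_weight_ge0.
exact: average_le.
Qed.

Lemma hit_weight_le1 n w u : (0 < d)%N -> (forall y, 0 <= w y) ->
  hit_weight n w u <= 1.
Proof.
move=> d0 w0; elim: n u => [|n IHn] u /=; first by case: eqP.
case: ifP => // _; rewrite -[leRHS]mulr1.
apply: ler_pM; rewrite ?expR_ge0 ?expR_le1 ?oppr_le0//.
  by apply: average_ge0 => y; exact: hit_weight_ge0.
by rewrite -[leRHS](average_cst 1 u d0) average_le.
Qed.

(** The sites whose potential the walk can collect in [n] steps, listed with
    repetitions. *)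
Fixpoint reach n u : seq (site d) :=
  if n is n'.+1 then
    u :: flatten [seq reach n' (u + unit_step i) | i <- enum {: direction}]
  else [::].

Lemma reach_step n u i y :
  y \in reach n (u + unit_step i) -> y \in reach n.+1 u.
Proof.
move=> H; rewrite inE; apply/orP; right; apply/flattenP.
by exists (reach n (u + unit_step i)) => //; apply/mapP; exists i; rewrite ?mem_enum.
Qed.

Lemma hit_weight_local n w w' u : (forall y, y \in reach n u -> w y = w' y) ->
  hit_weight n w u = hit_weight n w' u.
Proof.
elim: n u => [|n IHn] u ww //=; case: ifP => // _.
rewrite ww ?inE ?eqxx//; congr (_ * (_ * _)); apply: eq_bigr => i _.
by apply: IHn => y yr; apply: ww; exact: reach_step yr.
Qed.

(** Changing the potential at [z] by [D] multiplies the weight of a path with [l]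
    visits to [z] by [expR (- D * l)], which is at least
    [expR (- c) * (1 + c - D * l)].  The free parameter [c] makes the induction
    work, each visit to [z] replacing [c] by [c - D]; the choice of [c] that
    cancels the occupation term turns this into Jensen's inequality. *)
Lemma hit_weight_change z n w w' u D c :
  (forall y, y != z -> w' y = w y) -> w' z = w z + D ->
  expR (- c) * ((1 + c) * hit_weight n w u - D * occupation_weight z n w u)
  <= hit_weight n w' u.
Proof.
move=> ww wz; elim: n u c => [|n IHn] u c.
  rewrite /= mulr0 subr0 mulrA ler_piMl ?ler0n// expRN.
  by rewrite ler_pdivrMl ?expR_gt0// mulr1 expR_ge1Dx.
have aux c' : expR (- c') * ((1 + c') * average (hit_weight n w) u -
    D * average (occupation_weight z n w) u) <= average (hit_weight n w') u.
  have -> : expR (- c') * ((1 + c') * average (hit_weight n w) u -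
      D * average (occupation_weight z n w) u) = average (fun y =>
      expR (- c') * ((1 + c') * hit_weight n w y - D * occupation_weight z n w y)) u.
    rewrite averageZ; congr (_ * _).
    by rewrite -mulNr -!averageZ -averageD /average; congr (_ * _);
      apply: eq_bigr => i _; rewrite mulNr.
  by apply: average_le => y; exact: IHn.
rewrite occupation_weightS !hit_weightS; case: ifP => ux.
  rewrite mulr0 subr0 mulr1 expRN.
  by rewrite ler_pdivrMl ?expR_gt0// mulr1 expR_ge1Dx.
set a := average _ u in aux *; set b := average _ u in aux *.
have [uz|uz] := eqVneq u z.
  have -> : w' u = w u + D by rewrite uz.
  rewrite mul1r; apply: (le_trans _ (ler_wpM2l (expR_ge0 _) (aux (c - D)))).
  rewrite [leRHS]mulrA -expRD (_ : - (w u + D) - (c - D) = - c - w u); last by ring.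
  rewrite (expRD (- c) (- w u)) le_eqVlt; apply/orP; left; apply/eqP; ring.
rewrite mul0r add0r ww//.
apply: (le_trans _ (ler_wpM2l (expR_ge0 _) (aux c))).
by rewrite le_eqVlt; apply/orP; left; apply/eqP; ring.
Qed.

End Walk.

(** * Visits, range and sensitivity of the cost *)

Section WalkBounds.
Context (R : realType) (d : nat) (x : site d).
Implicit Types (w : site d -> R) (u y z : site d) (n m : nat).

Local Notation hit_weight := (hit_weight x).
Local Notation visit_weight := (visit_weight x).
Local Notation occupation_weight := (occupation_weight x).
Local Notation range_weight := (range_weight x).
Local Notation hit_prob := (@hit_prob R d).

Lemma hit_prob_ge0 z n u : 0 <= hit_prob z n u.
Proof.
elim: n u => [|n IHn] u; first by rewrite /= ler0n.
by rewrite hit_probS; case: ifP => // _; exact: average_ge0.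
Qed.

(** The walk has to hit [z] before it collects visits there. *)
Lemma occupation_le_hit_prob z n w u : (forall y, 0 <= w y) ->
  occupation_weight z n w u <= hit_prob z n u * occupation_weight z n w z.
Proof.
move=> w0; elim: n u => [|n IHn] u; first by rewrite /= mulr0.
have occ0 := @occupation_weight_ge0 R d x z n.+1 w.
have [->|uz] := eqVneq u z; first by rewrite hit_probS eqxx mul1r.
have [->|ux] := eqVneq u x.
  by rewrite occupation_weightS eqxx; apply: mulr_ge0; [exact: hit_prob_ge0|].
rewrite hit_probS (negPf uz) [leLHS]occupation_weightS (negPf ux) (negPf uz).
rewrite mul0r add0r.
have H1 : average (occupation_weight z n w) u <=
    average (hit_prob z n) u * occupation_weight z n w z.
  rewrite mulrC -averageZ; apply: average_le => y; rewrite mulrC; exact: IHn.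
have a0 : 0 <= average (occupation_weight z n w) u.
  by apply: average_ge0 => y; exact: occupation_weight_ge0.
have H2 : expR (- w u) <= 1 by rewrite expR_le1 oppr_le0.
apply: (le_trans (ler_wpM2r a0 H2)); rewrite mul1r; apply: (le_trans H1).
rewrite ler_wpM2l ?occupation_weight_nd//.
by apply: average_ge0 => y; exact: hit_prob_ge0.
Qed.

(** After each visit to [z] the path returns with weight at most [1 - kappa], so
    the mean number of visits is dominated by a geometric series. *)
Lemma occupation_le_hit (kappa : R) z n w : (forall y, 0 <= w y) ->
  (forall m, expR (- w z) * average (hit_prob z m) z <= 1 - kappa) ->
  kappa * occupation_weight z n w z <= hit_weight n w z.
Proof.
move=> w0 Hk; case: n => [|n]; first by rewrite mulr0 ler0n.
have [zx|zx] := eqVneq z x.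
  by rewrite occupation_weightS zx eqxx mulr0 hit_weight_at.
have H1 : expR (- w z) * average (occupation_weight z n w) z <=
    (1 - kappa) * occupation_weight z n.+1 w z.
  apply: (@le_trans _ _ (expR (- w z) * average (hit_prob z n) z *
      occupation_weight z n w z)).
    rewrite -mulrA ler_pM2l ?expR_gt0// mulrC -averageZ.
    by apply: average_le => y; rewrite mulrC; exact: occupation_le_hit_prob.
  apply: ler_pM; rewrite ?occupation_weight_ge0 ?occupation_weight_nd//.
  rewrite mulr_ge0 ?expR_ge0//; apply: average_ge0 => y; exact: hit_prob_ge0.
have : occupation_weight z n.+1 w z = hit_weight n.+1 w z +
    expR (- w z) * average (occupation_weight z n w) z.
  by rewrite {1}occupation_weightS (negPf zx) eqxx mul1r.
move: H1; lra.
Qed.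

Lemma occupation_le_visit (kappa : R) z n w u : (forall y, 0 <= w y) ->
  (forall m, expR (- w z) * average (hit_prob z m) z <= 1 - kappa) ->
  kappa * occupation_weight z n w u <= visit_weight z n w u.
Proof.
move=> w0 Hk; elim: n u => [|n IHn] u; first by rewrite mulr0.
rewrite visit_weightS; have [ux|ux] := eqVneq u x.
  by rewrite occupation_weightS ux eqxx mulr0.
have [->|uz] := eqVneq u z; first exact: occupation_le_hit.
rewrite occupation_weightS (negPf ux) (negPf uz) mul0r add0r mulrCA.
by rewrite ler_pM2l ?expR_gt0// -averageZ average_le.
Qed.

Lemma visit_weight_le_hit z n w u : visit_weight z n w u <= hit_weight n w u.
Proof.
elim: n u => [|n IHn] u; first exact: hit_weight_ge0.
rewrite visit_weightS; have [ux|ux] := eqVneq u x.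
  by rewrite hit_weight_ge0.
case: eqVneq => // _; rewrite hit_weightS (negPf ux).
by rewrite ler_pM2l ?expR_gt0// average_le.
Qed.

Lemma sum_visit_weight_step (s A : seq (site d)) n w u : uniq s -> u != x ->
  \sum_(z <- s | z \notin A) visit_weight z n.+1 w u <=
  (u \notin A)%:R * hit_weight n.+1 w u + expR (- w u) *
    \sum_(z <- s | z \notin u :: A) average (visit_weight z n w) u.
Proof.
move=> us ux; rewrite -big_filter; set s' := [seq z <- s | z \notin A].
have us' : uniq s' by exact: filter_uniq.
have rest : \sum_(z <- s' | z != u) visit_weight z n.+1 w u = expR (- w u) *
    \sum_(z <- s | z \notin u :: A) average (visit_weight z n w) u.
  rewrite big_filter_cond mulr_sumr; apply: eq_big => [z|z /andP[_ zu]].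
    by rewrite inE negb_or andbC.
  by rewrite visit_weightS (negPf ux) eq_sym (negPf zu).
have [us1|us1] := boolP (u \in s').
  have uA : u \notin A by move: us1; rewrite mem_filter => /andP[].
  rewrite (bigD1_seq u)// rest lerD2r visit_weightS (negPf ux) eqxx uA.
  by rewrite mul1r.
rewrite -rest -[leLHS]add0r; apply: lerD.
  by rewrite mulr_ge0 ?ler0n ?hit_weight_ge0.
rewrite le_eqVlt; apply/orP; left; apply/eqP.
rewrite big_seq [RHS]big_seq_cond; apply: eq_bigl => z.
have [->|] := eqVneq z u; first by rewrite (negPf us1).
by rewrite andbT.
Qed.

(** Jensen's inequality in the linear form
    [expR (c * N) >= expR b * (1 - b + c * N)], with [N] the number of distinct
    sites outside [A].  The parameter [b] is free because the induction
    replaces it by [b - c] at each new site. *)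
Lemma range_weight_ge (c b : R) (s A : seq (site d)) n w u : uniq s -> 0 <= c ->
  expR b * ((1 - b) * hit_weight n w u +
    c * \sum_(z <- s | z \notin A) visit_weight z n w u) <=
  range_weight c n w u A.
Proof.
move=> us c0.
have exp1B (b' : R) : expR b' * (1 - b') <= 1.
  by rewrite -ler_pdivlMl ?expR_gt0// mulr1 -expRN expR_ge1Dx.
elim: n b u A => [|n IHn] b u A.
  rewrite /= big1 ?mulr0 ?addr0// mulrA ler_piMl ?ler0n//.
have [ux|ux] := eqVneq u x.
  rewrite range_weightS hit_weightS ux eqxx big1 ?mulr0 ?addr0 ?mulr1//.
  by move=> z _; rewrite visit_weightS eqxx.
rewrite range_weightS hit_weightS (negPf ux).
have := sum_visit_weight_step A n w us ux.
rewrite hit_weightS (negPf ux).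
set k : R := (u \notin A)%:R; set S := \sum_(z <- s | z \notin A) _.
set S' := \sum_(z <- s | _) _; set a := average (hit_weight n w) u => HS.
have aux : expR (b - c * k) * ((1 - (b - c * k)) * a + c * S') <=
    average (fun y => range_weight c n w y (u :: A)) u.
  rewrite /S' /a -average_sum -!averageZ -averageD -averageZ.
  by apply: average_le => y; exact: IHn.
apply: (le_trans _ (ler_wpM2l (expR_ge0 _) aux)).
rewrite [leRHS]mulrA -expRD (_ : c * k - w u + (b - c * k) = b - w u); last by ring.
rewrite (expRD b) -mulrA ler_pM2l ?expR_gt0//.
have := ler_wpM2l c0 HS.
by set e := expR (- w u); move=> H; lra.
Qed.

Lemma l1norm_unit_step (i : direction d) : l1norm (unit_step i) = 1%N.
Proof.
rewrite /l1norm (bigD1 i.1)//= big1 => [|j ji].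
  by rewrite !mxE !eqxx mulr1 abszX addn0; case: i.2.
by rewrite !mxE eqxx (negPf ji) mulr0.
Qed.

Lemma unit_step_inj : injective (@unit_step d).
Proof.
move=> [i b] [j c] /matrixP/(_ ord0) H.
have := H i; rewrite !mxE !eqxx /= mulr1.
have [ij|ij] := eqVneq i j; last by rewrite mulr0; case: b {H}.
by rewrite mulr1 ij; case: b {H}; case: c.
Qed.

(** Iterated, this gives a path of length [l1norm (x - u)] from [u] to [x]. *)
Lemma closer_step u : u != x ->
  exists i, (l1norm (x - (u + unit_step i))).+1 = l1norm (x - u).
Proof.
move=> ux.
have [k vk] : exists k, (x - u) ord0 k != 0.
  apply: contrapT => /forallNP H; case/negP: ux; rewrite eq_sym -subr_eq0.
  by apply/eqP/rowP => j; rewrite [RHS]mxE; apply/eqP/negPn/negP; exact: H.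
exists (k, (x - u) ord0 k < 0)%R; rewrite opprD addrA.
move: (x - u) vk => v vk; rewrite /l1norm (bigD1 k)//= [RHS](bigD1 k)//=.
rewrite -addSn; congr (_ + _)%N; last first.
  apply: eq_bigr => j jk; rewrite !mxE eqxx (negPf jk) mulr0 subr0//.
rewrite (_ : (v - _) ord0 k = v ord0 k - (-1) ^+ (v ord0 k < 0)%R); last first.
  by rewrite !mxE !eqxx mulr1.
by move: (v ord0 k) vk => t vk; case: (ltP t 0) => /= ht; rewrite ?expr1 ?expr0; lia.
Qed.

Lemma hit_weight_step n w u i : u != x ->
  expR (- w u) * (2 * d)%:R^-1 * hit_weight n w (u + unit_step i) <=
  hit_weight n.+1 w u.
Proof.
move=> ux; rewrite hit_weightS (negPf ux) -mulrA ler_pM2l ?expR_gt0//.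
rewrite ler_wpM2l ?invr_ge0 ?ler0n// (bigD1 i)//= lerDl.
by apply: sumr_ge0 => j _; exact: hit_weight_ge0.
Qed.

Lemma hit_weight_gt0 n w u : (0 < d)%N -> (l1norm (x - u) <= n)%N ->
  0 < hit_weight n w u.
Proof.
move=> d0; elim: n u => [|n IHn] u lun.
  have [->|ux] := eqVneq u x; first by rewrite hit_weight_at.
  by have [i] := closer_step ux; move: lun; lia.
have [->|ux] := eqVneq u x; first by rewrite hit_weight_at.
have [i Hi] := closer_step ux.
apply: (lt_le_trans _ (hit_weight_step n w i ux)).
rewrite !mulr_gt0 ?expR_gt0 ?invr_gt0 ?ltr0n ?muln_gt0 ?IHn//.
by move: lun; rewrite -Hi.
Qed.

Definition cost n w u : R := - ln (hit_weight n w u).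

Lemma cost_ge0 n w u : (0 < d)%N -> (forall y, 0 <= w y) -> 0 <= cost n w u.
Proof. by move=> d0 w0; rewrite /cost oppr_ge0 ln_le0// hit_weight_le1. Qed.

Lemma cost_step n w u i : (0 < d)%N -> (l1norm (x - u) <= n.+1)%N -> u != x ->
  (l1norm (x - (u + unit_step i))).+1 = l1norm (x - u) ->
  cost n.+1 w u <= w u + ln (2 * d)%:R + cost n w (u + unit_step i).
Proof.
move=> d0 lun ux Hi.
have h0 : 0 < hit_weight n w (u + unit_step i).
  by apply: hit_weight_gt0 => //; move: lun; rewrite -Hi.
have d1 : 0 < (2 * d)%:R :> R by rewrite ltr0n muln_gt0.
have := hit_weight_step n w i ux.
rewrite -ler_ln ?posrE ?hit_weight_gt0// ?mulr_gt0 ?expR_gt0 ?invr_gt0//.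
rewrite lnM ?posrE ?mulr_gt0 ?expR_gt0 ?invr_gt0//.
rewrite lnM ?posrE ?expR_gt0 ?invr_gt0// expRK lnV ?posrE// /cost; lra.
Qed.

Lemma cost_anti n w w' u : (0 < d)%N -> (l1norm (x - u) <= n)%N ->
  (forall y, w y <= w' y) -> cost n w u <= cost n w' u.
Proof.
move=> d0 lun ww; rewrite lerN2 ler_ln ?posrE ?hit_weight_gt0//.
exact: hit_weight_anti.
Qed.

(** The mean number of visits to [z] under the path measure weighted by [w] is
    the derivative of the cost, a concave function, in the potential at [z];
    hence the bound on the increase uses path probabilities at [w] only. *)
Lemma cost_change (kappa : R) z n w w' u : (0 < d)%N ->
  (l1norm (x - u) <= n)%N -> 0 < kappa -> (forall y, 0 <= w y) ->
  (forall m, expR (- w z) * average (hit_prob z m) z <= 1 - kappa) ->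
  (forall y, y != z -> w' y = w y) -> 0 <= w' z ->
  Num.max (cost n w' u - cost n w u) 0 <=
  w' z / kappa * (visit_weight z n w u / hit_weight n w u).
Proof.
move=> d0 lun k0 w0 Hk ww w'z.
have h0 := hit_weight_gt0 w d0 lun; have h'0 := hit_weight_gt0 w' d0 lun.
have rhs0 : 0 <= w' z / kappa * (visit_weight z n w u / hit_weight n w u).
  by rewrite !mulr_ge0 ?visit_weight_ge0 ?invr_ge0// ltW.
rewrite ge_max rhs0 andbT.
have [ww'|ww'] := leP (w' z) (w z).
  apply: le_trans rhs0; rewrite subr_le0; apply: cost_anti => // y.
  by have [->//|/ww ->] := eqVneq y z.
set D := w' z - w z; set g := occupation_weight z n w u.
set h := hit_weight n w u in h0 *; set h' := hit_weight n w' u in h'0.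
have wD : w' z = w z + D by rewrite /D addrC subrK.
(* This parameter makes the bracket in the linear bound equal to h. *)
have := @hit_weight_change R d x z n w w' u D (D * g / h) ww wD.
rewrite -/h -/h' -/g.
have -> : (1 + D * g / h) * h - D * g = h by field; rewrite gt_eqF.
rewrite -ler_ln ?posrE ?mulr_gt0 ?expR_gt0// lnM ?posrE ?expR_gt0// expRK.
move=> H.
apply: (@le_trans _ _ (D * g / h)); first by rewrite /cost -/h -/h'; lra.
rewrite [leRHS]mulrA ler_wpM2r ?invr_ge0 ?(ltW h0)//.
have g0 : 0 <= g := occupation_weight_ge0 x z n w u.
have gv : g <= visit_weight z n w u / kappa.
  by rewrite ler_pdivlMr// mulrC; exact: occupation_le_visit.
rewrite -mulrA (mulrC kappa^-1); apply: ler_pM => //; rewrite /D; first lra.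
by have := w0 z; lra.
Qed.

End WalkBounds.

(** * Log-Laplace transform of the cost for a finite law *)

Section FiniteLaw.
Context (R : realType) (d : nat) (d_gt0 : (0 < d)%N) (x : site d).
Context (I : finType) (p v : I -> R).
Hypotheses (p_ge0 : forall i, 0 <= p i) (p_sum1 : \sum_i p i = 1).
Hypothesis v_ge0 : forall i, 0 <= v i.
Context (m2 c kappa : R).
Hypothesis second_moment : \sum_i p i * v i ^+ 2 <= m2.
Hypotheses (c_gt0 : 0 < c) (new_site : \sum_i p i * expR (c - v i) <= 1).
Hypothesis kappa_gt0 : 0 < kappa.
Hypothesis escape : forall i z m,
  expR (- v i) * average (@hit_prob R d z m) z <= 1 - kappa.

Implicit Types (w : site d -> I) (u y z : site d) (s A : seq (site d)).

Let potential w : site d -> R := fun z => v (w z).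

Let potential_ge0 w z : 0 <= potential w z.
Proof. exact: v_ge0. Qed.

Lemma exp_average (E : ((site d -> I) -> R) -> R) (HE : is_expectation E)
    (F : site d -> (site d -> I) -> R) u :
  E (fun w => average (fun y => F y w) u) = average (fun y => E (F y)) u.
Proof. by rewrite /average (expZ HE) (exp_sum HE). Qed.

(** At each new site the factor [expR (c - v)] averages to at most 1; at a site
    visited before, the factor is at most 1.  [F] holds the factors of the sites
    already visited, so it does not depend on the potential at a new site. *)
Lemma resample_range_weight_le s n u A w0 (F : (site d -> I) -> R) :
  {subset reach n u <= s} -> (forall w, 0 <= F w) ->
  (forall z, z \notin A -> free_of F z) ->
  resample_seq p s (fun w => F w * range_weight x c n (potential w) u A) w0 <=
  resample_seq p s F w0.
Proof.
have HE := resample_seq_expectation p_ge0 p_sum1 s w0.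
elim: n u A F => [|n IHn] u A F rs F0 FA.
  by apply: (exp_le HE) => w /=; rewrite ler_piMr//; case: (u == x).
have [ux|ux] := eqVneq u x.
  by apply: (exp_le HE) => w; rewrite range_weightS ux eqxx mulr1.
have us : u \in s by apply: rs; rewrite inE eqxx.
pose F' w := F w * expR (c * (u \notin A)%:R - v (w u)).
have -> : (fun w => F w * range_weight x c n.+1 (potential w) u A) =
   (fun w => average (fun y => F' w * range_weight x c n (potential w) y (u :: A)) u).
  by apply/funext => w; rewrite range_weightS (negPf ux) averageZ mulrA.
rewrite (exp_average HE).
apply: (@le_trans _ _ (resample_seq p s F' w0)).
  rewrite -[leRHS](average_cst _ u d_gt0) /average.
  rewrite ler_wpM2l ?invr_ge0 ?ler0n//; apply: ler_sum => i _.
  apply: IHn.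
  - by move=> y yr; apply: rs; exact: reach_step yr.
  - by move=> w; rewrite mulr_ge0 ?expR_ge0.
  - move=> z; rewrite inE negb_or => /andP[zu zA] w i'.
    by rewrite /F' (FA _ zA) update_other// eq_sym.
have [uA|uA] := boolP (u \in A).
  apply: (exp_le HE) => w; rewrite /F' uA mulr0 add0r ler_piMr//.
  by rewrite expR_le1 oppr_le0.
rewrite -(resample_seq_absorb p_sum1 F' us).
apply: (exp_le HE) => w; rewrite /resample.
have -> : \sum_i p i * F' (update w u i) = F w * \sum_i p i * expR (c - v i).
  rewrite mulr_sumr; apply: eq_bigr => i _.
  by rewrite /F' uA mulr1 (FA _ uA) update_same mulrCA.
exact: ler_piMr.
Qed.

(** Since [v <= 1 + v ^ 2]. *)
Lemma mean_value_le : \sum_i p i * v i <= 1 + m2.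
Proof.
rewrite -[X in X + _]p_sum1; apply: (le_trans _ (lerD (lexx _) second_moment)).
rewrite -big_split/=; apply: ler_sum => i _.
by rewrite -[X in X + _]mulr1 -mulrDr ler_wpM2l//; nra.
Qed.

(** A shortest path costs at most its potentials plus [ln (2 * d)] per step. *)
Lemma resample_cost_le s n u w0 : {subset reach n u <= s} ->
  (l1norm (x - u) <= n)%N ->
  resample_seq p s (fun w => cost x n (potential w) u) w0 <=
  (l1norm (x - u))%:R * (1 + m2 + ln (2 * d)%:R).
Proof.
have HE := resample_seq_expectation p_ge0 p_sum1 s w0.
set M := 1 + m2 + _.
have atx n' : resample_seq p s (fun w => cost x n' (potential w) x) w0 <=
    (l1norm (x - x))%:R * M.
  rewrite (_ : (fun w => _) = (fun=> 0)) ?(exp_cst HE); last first.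
    by apply/funext => w; rewrite /cost hit_weight_at ln1 oppr0.
  by rewrite subrr /l1norm big1 ?mul0r// => i _; rewrite mxE.
elim: n u => [|n IHn] u rs lun; have [->//|ux] := eqVneq u x.
  by have [i] := closer_step ux; move: lun; case: l1norm.
have us : u \in s by apply: rs; rewrite inE eqxx.
have [i Hi] := closer_step ux.
have Hcost w : cost x n.+1 (potential w) u <=
    potential w u + ln (2 * d)%:R + cost x n (potential w) (u + unit_step i).
  exact: cost_step.
apply: (le_trans (exp_le HE Hcost)).
rewrite !(expD HE) (exp_cst HE) -Hi -natr1 mulrDl mul1r addrC.
apply: lerD.
  apply: IHn; last by move: lun; rewrite -Hi.
  by move=> y yr; apply: rs; exact: reach_step yr.
rewrite lerD2r -(resample_seq_absorb p_sum1 _ us).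
apply: (le_trans _ mean_value_le); rewrite -[leRHS](exp_cst HE).
apply: (exp_le HE) => w; rewrite /resample le_eqVlt; apply/orP; left.
by apply/eqP/eq_bigr => j _; rewrite /potential update_same.
Qed.

Context (n : nat) (xn : (l1norm x <= n)%N) (w0 : site d -> I).

Let s := undup (reach n (0 : site d)).
Let E (F : (site d -> I) -> R) : R := resample_seq p s F w0.
Let a w := cost x n (potential w) 0.
Let h w := hit_weight x n (potential w) 0.
Let q z w := visit_weight x z n (potential w) 0 / h w.
Let Z w := range_weight x c n (potential w) 0 [::].

Let HE : is_expectation E.
Proof. exact: resample_seq_expectation. Qed.

Let x0n : (l1norm (x - 0) <= n)%N.
Proof. by rewrite subr0. Qed.

Let h_gt0 w : 0 < h w.
Proof. exact: hit_weight_gt0. Qed.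

Let Z_gt0 w : 0 < Z w.
Proof. by apply: range_weight_gt0; exact: h_gt0. Qed.

Let q_ge0 z w : 0 <= q z w.
Proof. by rewrite divr_ge0 ?visit_weight_ge0// ltW// h_gt0. Qed.

Let q_le1 z w : q z w <= 1.
Proof. by rewrite ler_pdivrMr// mul1r visit_weight_le_hit. Qed.

(** The Jensen bound on [Z] at its optimal parameter [b = c * \sum_z q z]. *)
Lemma sum_visit_prob_le w : c * \sum_(z <- s) q z w <= a w + ln (Z w).
Proof.
set Q := \sum_(z <- s) q z w.
have := @range_weight_ge R d x c (c * Q) s [::] n (potential w) 0
  (undup_uniq _) (ltW c_gt0).
rewrite -/(h w) -/(Z w).
have -> : \sum_(z <- s | z \notin [::]) visit_weight x z n (potential w) 0 = Q * h w.
  rewrite mulr_suml; apply: eq_bigr => z _.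
  by rewrite divfK// gt_eqF.
have -> : (1 - c * Q) * h w + c * (Q * h w) = h w by ring.
rewrite -ler_ln ?posrE ?mulr_gt0 ?expR_gt0// lnM ?posrE ?expR_gt0// expRK.
rewrite /a /cost -/(h w); lra.
Qed.

(** The increase of the cost under resampling is at most the new value times
    [q z / kappa]; the new value is independent of the weight
    [expR (- mu * a)] at the old one, and contributes its second moment. *)
Lemma coordinate_entropy_cost_le mu z w : 0 <= mu ->
  coordinate_entropy p z (fun w => expR (- mu * a w)) w <=
  resample p z (fun w => mu ^+ 2 * m2 / kappa ^+ 2 *
    (expR (- mu * a w) * q z w ^+ 2)) w.
Proof.
move=> mu0; apply: (le_trans (coordinate_entropy_le p_ge0 p_sum1 z (fun w => - mu * a w) w)).
apply: ler_sum => i _; apply: ler_wpM2l => //.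
set wi := update w z i.
apply: (@le_trans _ _ (\sum_j (p j * v j ^+ 2) *
   (mu ^+ 2 / kappa ^+ 2 * (expR (- mu * a wi) * q z wi ^+ 2)))).
  apply: ler_sum => j _; rewrite -mulrA ler_wpM2l//.
  set wj := update w z j.
  have H : Num.max (a wj - a wi) 0 <= v j / kappa * q z wi.
    have := @cost_change R d x kappa z n (potential wi) (potential wj) 0 d_gt0 x0n.
    have -> : potential wj z = v j by rewrite /potential /wj update_same.
    apply => //; first by move=> k; exact: escape.
    by move=> y yz; rewrite /potential /wi /wj !update_other.
  have -> : Num.max (- mu * a wi - - mu * a wj) 0 = mu * Num.max (a wj - a wi) 0.
    by rewrite maxr_pMr// mulr0; congr Num.max; ring.
  have m0 : 0 <= Num.max (a wj - a wi) 0 by rewrite le_max lexx orbT.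
  have -> : v j ^+ 2 * (mu ^+ 2 / kappa ^+ 2 * (expR (- mu * a wi) * q z wi ^+ 2)) =
     expR (- mu * a wi) * (mu * (v j / kappa * q z wi)) ^+ 2.
    by field; rewrite gt_eqF.
  rewrite ler_pM2l ?expR_gt0//; apply: lerXn2r; rewrite ?nnegrE.
  - exact: mulr_ge0.
  - rewrite mulr_ge0// mulr_ge0 ?q_ge0// mulr_ge0 ?invr_ge0 ?v_ge0//.
    exact: ltW.
  - by rewrite ler_wpM2l.
rewrite -mulr_suml.
have -> : mu ^+ 2 * m2 / kappa ^+ 2 * (expR (- mu * a wi) * q z wi ^+ 2) =
  m2 * (mu ^+ 2 / kappa ^+ 2 * (expR (- mu * a wi) * q z wi ^+ 2)) by ring.
rewrite ler_wpM2r//; apply: mulr_ge0; first by rewrite divr_ge0 ?sqr_ge0.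
by apply: mulr_ge0; [exact: expR_ge0|exact: sqr_ge0].
Qed.

Let K := m2 / (kappa ^+ 2 * c).

Let m2_ge0 : 0 <= m2.
Proof.
by apply: le_trans second_moment; apply: sumr_ge0 => i _; rewrite mulr_ge0 ?sqr_ge0.
Qed.

Let K_ge0 : 0 <= K.
Proof. by rewrite divr_ge0// mulr_ge0 ?sqr_ge0// ltW. Qed.

(** [q z ^ 2 <= q z], and [\sum_z q z] is bounded by [(a + ln Z) / c].  The [a] part
    is decoupled by association; the [ln Z] part is at most the entropy itself,
    which the condition on [mu] lets one absorb. *)
Lemma entropy_cost_le mu : 0 <= mu -> K * mu ^+ 2 <= 1 / 2 ->
  entropy E (fun w => expR (- mu * a w)) <=
  2 * K * E a * mu ^+ 2 * E (fun w => expR (- mu * a w)).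
Proof.
move=> mu0 Kmu; set Y := fun w => expR (- mu * a w).
have Y0 w : 0 < Y w by exact: expR_gt0.
have us : uniq s := undup_uniq _.
set B := mu ^+ 2 * m2 / kappa ^+ 2.
have B0 : 0 <= B by rewrite divr_ge0 ?sqr_ge0// mulr_ge0 ?sqr_ge0.
have H1 : entropy E Y <= B * E (fun w => Y w * \sum_(z <- s) q z w).
  apply: (le_trans (entropy_tensorization p_ge0 p_sum1 w0 us Y0)).
  apply: (@le_trans _ _ (\sum_(z <- s) E (fun w => B * (Y w * q z w ^+ 2)))).
    rewrite big_seq [leRHS]big_seq; apply: ler_sum => z zs.
    rewrite -/(E _) /E -(resample_seq_absorb p_sum1 (fun w => B * _) zs).
    by apply: (exp_le HE) => w; exact: coordinate_entropy_cost_le.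
  rewrite -(exp_sum HE) -(expZ HE); apply: (exp_le HE) => w.
  rewrite -mulr_sumr ler_wpM2l// mulr_sumr; apply: ler_sum => z _.
  rewrite ler_pM2l// expr2 ler_piMr//.
have H2 : c * E (fun w => Y w * \sum_(z <- s) q z w) <= E Y * E a + entropy E Y.
  rewrite -(expZ HE).
  apply: (@le_trans _ _ (E (fun w => Y w * a w + Y w * ln (Z w)))).
    apply: (exp_le HE) => w; rewrite mulrCA -mulrDr ler_pM2l//.
    exact: sum_visit_prob_le.
  rewrite (expD HE); apply: lerD; first exact: (exp_mul_expR_le HE).
  apply: (entropy_variational HE) => //.
  rewrite -[leRHS](exp1 HE).
  have -> : E Z = E (fun w => 1 * Z w) by apply: exp_eq => w; rewrite mul1r.
  apply: resample_range_weight_le => //.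
  by move=> y; rewrite mem_undup.
have EY0 : 0 < E Y := exp_gt0 HE Y0.
have H3 : entropy E Y <= K * mu ^+ 2 * (E Y * E a + entropy E Y).
  apply: (le_trans H1).
  have -> : K * mu ^+ 2 * (E Y * E a + entropy E Y) =
      B * (c^-1 * (E Y * E a + entropy E Y)).
    by rewrite /K /B; field; rewrite !gt_eqF.
  by rewrite ler_wpM2l// ler_pdivlMl.
have Ea0 : 0 <= E a.
  rewrite -(exp_cst HE 0); apply: (exp_le HE) => w; exact: cost_ge0.
have T0 : 0 <= K * mu ^+ 2 by rewrite mulr_ge0 ?sqr_ge0.
have G0 : 0 <= E Y * E a by rewrite mulr_ge0// ltW.
have -> : 2 * K * E a * mu ^+ 2 * E Y = 2 * (K * mu ^+ 2) * (E Y * E a) by ring.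
move: H3 Kmu T0 G0.
move: (K * mu ^+ 2) (entropy E Y) (E Y * E a) => T e G H3 HT T0 G0.
have [e0|e0] := leP e 0; first by apply: (le_trans e0); rewrite !mulr_ge0.
nra.
Qed.

Theorem cost_log_laplace mu : 0 <= mu -> K * mu ^+ 2 <= 1 / 2 ->
  let M := (l1norm x)%:R * (1 + m2 + ln (2 * d)%:R) in
  E a <= M /\
  E (fun w => expR (- mu * a w)) <= expR (- mu * E a + 4 * K * M * mu ^+ 2).
Proof.
move=> mu0 Kmu M.
have EaM : E a <= M.
  have := @resample_cost_le s n 0 w0 _ x0n; rewrite subr0; apply.
  by move=> y; rewrite mem_undup.
split=> //.
have a0 w : 0 <= a w by exact: cost_ge0.
have Ea0 : 0 <= E a by rewrite -(exp_cst HE 0); apply: (exp_le HE).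
have KE : 0 <= 2 * K * E a by apply: mulr_ge0 => //; apply: mulr_ge0.
have hmu : 0 <= mu <= mu by rewrite mu0 lexx.
apply: (le_trans (@herbst _ _ E HE a _ mu KE a0 _ mu hmu)).
  move=> nu /andP[nu0 numu]; apply: entropy_cost_le => //.
  apply: le_trans Kmu; rewrite ler_wpM2l// lerXn2r//.
rewrite ler_expR lerD2l.
have -> : 2 * (2 * K * E a) * mu ^+ 2 = 4 * K * mu ^+ 2 * E a by ring.
have -> : 4 * K * M * mu ^+ 2 = 4 * K * mu ^+ 2 * M by ring.
by rewrite ler_wpM2l//; apply: mulr_ge0; [exact: mulr_ge0|exact: sqr_ge0].
Qed.

End FiniteLaw.

(** * Transience in dimension at least three *)

Section Transience.
Context (R : realType) (d : nat) (d_ge3 : (3 <= d)%N).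
Implicit Types (u y z : site d).

Let root4 (t : R) : R := Num.sqrt (Num.sqrt t).

Let root4_gt0 t : 0 < t -> 0 < root4 t.
Proof. by move=> t0; rewrite !sqrtr_gt0. Qed.

Let root4K t : 0 <= t -> root4 t ^+ 4 = t.
Proof.
by move=> t0; rewrite (exprM _ 2 2) !sqr_sqrtr ?sqrtr_ge0.
Qed.

(** With [y = (1 + e) ^ (1 / 4)]: the second-order expansion of
    [(1 + e) ^ (- 1 / 4)], its coefficient 5/32 enlarged to 9/50 to cover all
    [e] not too negative.  The difference of the two sides is [(y - 1) ^ 2] times a
    polynomial that is positive on this range. *)
Lemma inv_le_quartic (y : R) : 97 / 100 <= y ->
  y^-1 <= 1 - (y ^+ 4 - 1) / 4 + 9 / 50 * (y ^+ 4 - 1) ^+ 2.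
Proof.
move=> y1; have y0 : 0 < y by lra.
rewrite -[leLHS]mul1r ler_pdivrMr//.
set P := y ^+ 3 + y ^+ 2 + y + 1.
have y2 : 94 / 100 <= y ^+ 2 by nra.
have y3 : 91 / 100 <= y ^+ 3.
  rewrite exprS; apply: (@le_trans _ _ (97 / 100 * (94 / 100))); first lra.
  by apply: ler_pM => //; lra.
have HP : 38 / 10 <= P by rewrite /P; lra.
have H1 : 27 / 10 * (y * P) <= 72 / 100 * (y * P ^+ 2).
  have : 0 < y * P by rewrite mulr_gt0//; lra.
  rewrite expr2; nra.
have H2 : y ^+ 3 + 2 * y ^+ 2 + 3 * y + 4 <= 27 / 10 * (y * P).
  have -> : y * P = y * y ^+ 3 + y ^+ 3 + y ^+ 2 + y by rewrite /P; ring.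
  nra.
have : 0 <= (y - 1) ^+ 2 * (72 / 100 * (y * P ^+ 2) - (y ^+ 3 + 2 * y ^+ 2 + 3 * y + 4)).
  by rewrite mulr_ge0 ?sqr_ge0//; lra.
have -> : (y - 1) ^+ 2 * (72 / 100 * (y * P ^+ 2) - (y ^+ 3 + 2 * y ^+ 2 + 3 * y + 4))
  = 4 * ((1 - (y ^+ 4 - 1) / 4 + 9 / 50 * (y ^+ 4 - 1) ^+ 2) * y - 1).
  by rewrite /P; field.
lra.
Qed.

Lemma inv_root4_le (t t' : R) : 0 < t -> 9 / 10 * t <= t' ->
  (root4 t')^-1 <= (root4 t)^-1 *
    (1 - ((t' - t) / t) / 4 + 9 / 50 * ((t' - t) / t) ^+ 2).
Proof.
move=> t0 tt'; have t'0 : 0 < t' by lra.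
have s0 := root4_gt0 t0; have s'0 := root4_gt0 t'0.
pose y := root4 t' / root4 t.
have y0 : 0 < y by exact: divr_gt0.
have y4 : y ^+ 4 - 1 = (t' - t) / t.
  by rewrite /y expr_div_n !root4K ?ltW// mulrBl divff// gt_eqF.
have y1 : 97 / 100 <= y.
  rewrite leNgt; apply/negP => yl.
  have : y ^+ 4 <= (97 / 100) ^+ 4 by apply: lerXn2r; rewrite ?nnegrE; lra.
  have : 9 / 10 <= y ^+ 4.
    have -> : y ^+ 4 = t' / t by rewrite -[LHS](subrK 1) y4; field; rewrite gt_eqF.
    by rewrite ler_pdivlMr.
  lra.
have := inv_le_quartic y1; rewrite y4 => H.
have -> : (root4 t')^-1 = (root4 t)^-1 * y^-1.
  by rewrite /y; field; rewrite !gt_eqF.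
by rewrite ler_pM2l// invr_gt0.
Qed.

Context (b : R) (b_ge : 400 <= b).

Let b_gt0 : 0 < b.
Proof. by move: b_ge; lra. Qed.

Let coord u i : R := (u ord0 i)%:~R.
Let height z u : R := \sum_i coord (u - z) i ^+ 2 + b.

Let height_gt0 z u : 0 < height z u.
Proof. by apply: ltr_wpDl => //; apply: sumr_ge0 => i _; rewrite sqr_ge0. Qed.

Let height_step z u i : height z (u + unit_step i) =
  height z u + 1 + 2 * (-1) ^+ i.2 * coord (u - z) i.1.
Proof.
rewrite /height (bigD1 i.1)//= [in RHS](bigD1 i.1)//=.
rewrite (eq_bigr (fun j => coord (u - z) j ^+ 2)); last first.
  move=> j ji; rewrite /coord !mxE eqxx (negPf ji) mulr0 addr0//.
have -> : coord (u + unit_step i - z) i.1 = coord (u - z) i.1 + (-1) ^+ i.2.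
  rewrite /coord !mxE !eqxx mulr1 addrAC intrD; congr (_ + _).
  by case: i.2; rewrite ?expr1 ?expr0.
have : ((-1) ^+ i.2) ^+ 2 = 1 :> R by rewrite sqrr_sign.
by set e := (-1) ^+ i.2; set S := \sum_(j | _) _; set t := coord _ _ => He; lra.
Qed.

(** Away from the origin [|u| ^ (- 1 / 2)] is strictly superharmonic in dimension
    at least 3: at second order, the mean of [(1 + e) ^ (- 1 / 4)] over the
    neighbours falls short of 1 by [(1 / 4 - 4 * C / d) / height], with
    [C = 9 / 50 < 3 / 16].  The shift [b >= 400] in [height] keeps [e] small
    everywhere, including near the origin. *)
Lemma superharmonic z u :
  average (fun y => (root4 (height z y))^-1) u <= (root4 (height z u))^-1.
Proof.
set N := height z u; have N0 : 0 < N := height_gt0 z u.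
pose t i := coord (u - z) i.
have NE : N = \sum_i t i ^+ 2 + b by [].
have tN i : t i ^+ 2 + b <= N.
  by rewrite NE lerD2r (bigD1 i)//= lerDl sumr_ge0// => j _; rewrite sqr_ge0.
pose e (k : direction d) := (1 + 2 * (-1) ^+ k.2 * t k.1) / N.
have H k : (root4 (height z (u + unit_step k)))^-1 <=
    (root4 N)^-1 * (1 - e k / 4 + 9 / 50 * e k ^+ 2).
  rewrite height_step -/N -/(t _).
  have -> : e k = (N + 1 + 2 * (-1) ^+ k.2 * t k.1 - N) / N.
    by rewrite /e; congr (_ / _); ring.
  apply: inv_root4_le => //; have := tN k.1; have := b_ge.
  by case: k.2; rewrite ?expr1 ?expr0; nra.
apply: (@le_trans _ _ ((2 * d)%:R^-1 * \sum_(k : direction d)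
    (root4 N)^-1 * (1 - e k / 4 + 9 / 50 * e k ^+ 2))).
  by rewrite ler_wpM2l ?invr_ge0 ?ler0n// ler_sum.
rewrite -mulr_sumr mulrCA ler_piMr ?invr_ge0 ?(ltW (root4_gt0 _))//.
have d0 : 0 < (2 * d)%:R :> R by rewrite ltr0n muln_gt0 (leq_trans _ d_ge3).
rewrite mulrC ler_pdivrMr// mul1r.
have -> : \sum_(k : direction d) (1 - e k / 4 + 9 / 50 * e k ^+ 2) =
   \sum_(i < d) (2 - 1 / (2 * N) + 9 / 50 * (2 + 8 * t i ^+ 2) / N ^+ 2).
  rewrite (eq_bigr (fun k : 'I_d * bool => (fun i b =>
     1 - e (i, b) / 4 + 9 / 50 * e (i, b) ^+ 2) k.1 k.2)); last by case.
  rewrite -(pair_bigA _ (fun i b => 1 - e (i, b) / 4 + 9 / 50 * e (i, b) ^+ 2))/=.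
  apply: eq_bigr => i _; rewrite big_bool /e /= expr1 expr0.
  by field; rewrite gt_eqF.
rewrite big_split sumr_const card_ord/= -mulr_suml -mulr_sumr big_split/=.
rewrite sumr_const card_ord -mulr_sumr.
have -> : \sum_i t i ^+ 2 = N - b by rewrite NE; ring.
have N1 : b <= N by rewrite NE lerDr sumr_ge0// => i _; rewrite sqr_ge0.
have d3 : 3 <= d%:R :> R by rewrite ler_nat.
rewrite -[X in X + _]mulr_natr -[X in 9 / 50 * (X + _)]mulr_natr natrM.
set D : R := d%:R in d3 *.
rewrite -subr_ge0.
have -> : 2 * D - ((2 - 1 / (2 * N)) * D + 9 / 50 * (2 * D + 8 * (N - b)) / N ^+ 2) =
  (D * N / 2 - 9 / 50 * (2 * D + 8 * (N - b))) / N ^+ 2.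
  by field; rewrite gt_eqF.
apply: divr_ge0; last exact: sqr_ge0.
have DN : 0 <= (D - 3) * (N - 400) by apply: mulr_ge0; move: b_ge; lra.
move: b_ge; nra.
Qed.

Lemma hit_prob_le_potential z n u :
  hit_prob R z n u * (root4 b)^-1 <= (root4 (height z u))^-1.
Proof.
have hz : height z z = b.
  by rewrite /height subrr big1 ?add0r// => i _; rewrite /coord mxE expr0n.
elim: n u => [|n IHn] u.
  rewrite /=; have [->|_] := eqVneq u z; first by rewrite mul1r hz.
  by rewrite mul0r invr_ge0 ltW// root4_gt0.
rewrite hit_probS; have [->|_] := eqVneq u z; first by rewrite mul1r hz.
apply: le_trans (superharmonic z u).
by rewrite mulrC -averageZ; apply: average_le => y; rewrite mulrC.
Qed.

(** The superharmonic function is strictly smaller at the neighbours of [z] than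
    at [z]; the ratio of the two values bounds the return probability. *)
Lemma return_prob_le z n :
  average (hit_prob R z n) z <= (root4 (b + 1))^-1 / (root4 b)^-1.
Proof.
have s0 := root4_gt0 b_gt0.
rewrite ler_pdivlMr ?invr_gt0// mulrC -averageZ.
rewrite -[leRHS](@average_cst R d _ z (leq_trans _ d_ge3))//.
rewrite /average ler_wpM2l ?invr_ge0 ?ler0n// ler_sum// => i _.
rewrite mulrC; apply: (le_trans (hit_prob_le_potential _ _ _)).
rewrite height_step.
have -> : height z z = b.
  by rewrite /height subrr big1 ?add0r// => j _; rewrite /coord mxE expr0n.
by rewrite subrr /coord mxE mulr0 addr0.
Qed.

Lemma transience_of_shift : exists2 rho : R, rho < 1 &
  forall z n, average (hit_prob R z n) z <= rho.
Proof.
exists ((root4 (b + 1))^-1 / (root4 b)^-1); last exact: return_prob_le.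
have s0 := root4_gt0 b_gt0.
have b10 : 0 < b + 1 by rewrite addr_gt0.
rewrite invrK mulrC ltr_pdivrMr ?root4_gt0// mul1r.
by rewrite /root4 ltr_sqrt ?sqrtr_gt0// ltr_sqrt// ltrDl.
Qed.

End Transience.

Lemma transience (R : realType) (d : nat) : (3 <= d)%N ->
  exists2 rho : R, rho < 1 &
    forall z n, average (@hit_prob R d z n) z <= rho.
Proof. by move=> d_ge3; exact: (transience_of_shift d_ge3 (lexx 400)). Qed.

(** * Integration over the pieces of a partition *)

Section Partition.
Context (R : realType) (dT : measure_display) (T : measurableType dT).
Context (mu : probability T R).
Local Open Scope ereal_scope.

(** The pieces are only required to carry the whole mass of [A]: they leave out
    the transitions, or the levels, of probability zero. *)
Lemma integral_partition (J : finType) (A : set T) (B : J -> set T)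
    (f : T -> \bar R) :
  measurable A -> (forall j, measurable (B j)) -> (forall j, B j `<=` A) ->
  (forall i j v, B i v -> B j v -> i = j) ->
  \sum_(j : J) mu (B j) = mu A ->
  measurable_fun setT f -> (forall v, 0 <= f v) ->
  \int[mu]_(v in A) f v = \sum_(j : J) \int[mu]_(v in B j) f v.
Proof.
move=> mA mB BA Bdisj Bsum mf f0.
pose D := \big[setU/set0]_(j <- index_enum J) B j.
have mD : measurable D by exact: bigsetU_measurable.
have DA : D `<=` A.
  by rewrite /D; elim/big_ind : _ => // X Y XA YA v [/XA|/YA].
have tB : trivIset [set` index_enum J] B.
  by move=> i j _ _ [v [Bi Bj]]; exact: Bdisj Bi Bj.
have intD (g : T -> \bar R) : measurable_fun setT g -> (forall v, 0 <= g v) ->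
    \int[mu]_(v in D) g v = \sum_(j : J) \int[mu]_(v in B j) g v.
  move=> mg g0; apply: ge0_integral_bigsetU => //; first exact: index_enum_uniq.
  exact: measurable_funTS.
have muD : mu D = mu A.
  rewrite -Bsum -[LHS]mul1e -integral_cst// intD//.
  by apply: eq_bigr => j _; rewrite integral_cst// mul1e.
have mAD : measurable (A `\` D) by exact: measurableD.
have muAD : mu (A `\` D) = 0.
  rewrite measureD ?setIidr//; last first.
    by rewrite (le_lt_trans (probability_le1 mu mA)) ?ltry.
  transitivity (mu D - mu D); first by congr (_ - _); exact: esym.
  by rewrite subee// fin_num_measure.
rewrite -(setDUK DA) ge0_integral_setU//.
- rewrite intD// (null_set_integral mAD _ muAD) ?adde0//.
  exact: measurable_funTS.
- by apply: measurable_funTS.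
- by rewrite disj_set2E setDIK.
Qed.

Lemma integral_full (A : set T) (f : T -> \bar R) :
  measurable A -> mu A = 1 -> measurable_fun setT f -> (forall v, 0 <= f v) ->
  \int[mu]_v f v = \int[mu]_(v in A) f v.
Proof.
move=> mA A1 mf f0; rewrite (@integral_partition unit setT (fun=> A))//.
- by rewrite (big_pred1 tt)// => -[].
- by move=> [] [].
- by rewrite (big_pred1 tt) ?A1 ?probability_setT// => -[].
Qed.

Lemma integral_const_on (A : set T) (f : T -> \bar R) c : measurable A ->
  (forall v, A v -> f v = c) -> \int[mu]_(v in A) f v = c * mu A.
Proof.
move=> mA fc; rewrite -integral_cst//; apply: eq_integral => v.
by rewrite inE => /fc.
Qed.

Lemma preimage_countable_measurable (U : countType) (g : T -> U) :
  (forall y, measurable [set v | g v = y]) ->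
  forall Q : set U, measurable [set v | Q (g v)].
Proof.
move=> mg Q.
rewrite (_ : [set v | Q (g v)] =
    \bigcup_y (if `[< Q y >] then [set v | g v = y] else set0)).
  by apply: countable_bigcupT_measurable => // y; case: ifP.
apply/seteqP; split => v /=.
  by move=> Qv; exists (g v) => //; case: asboolP.
by move=> [y _]; case: asboolP => // Qy ->.
Qed.

Lemma measurable_fun_countable dU (U : measurableType dU) (V : countType)
    (g : T -> V) (h : V -> U) :
  (forall y, measurable [set v | g v = y]) -> measurable_fun setT (h \o g).
Proof.
move=> mg _ Y mY; rewrite setTI.
exact: (preimage_countable_measurable mg (h @^-1` Y)).
Qed.

Lemma fatou_le (f : nat -> T -> R) (g : T -> R) (C : R) (N : nat) :
  (forall n, measurable_fun setT (f n)) -> (forall n v, (0 <= f n v)%R) ->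
  (forall v, f n v @[n --> \oo] --> g v) ->
  (forall n, (N <= n)%N -> \int[mu]_v (f n v)%:E <= C%:E) ->
  \int[mu]_v (g v)%:E <= C%:E.
Proof.
move=> mf f0 fg fC.
have mfN n : measurable_fun setT (fun v => (f (n + N)%N v)%:E).
  exact/measurable_EFinP.
have fN0 n v : [set: T] v -> 0 <= (f (n + N)%N v)%:E by rewrite lee_fin.
have := fatou mu measurableT mfN fN0.
rewrite (eq_integral (fun v => (g v)%:E)); last first.
  move=> v _; have H : (f (n + N)%N v)%:E @[n --> \oo] --> (g v)%:E.
    by apply: cvg_EFin; [exact: nearW|rewrite (cvg_shiftn N (fun n => f n v))].
  by have [] := cvg_limn_einf_sup H.
move=> /le_trans; apply; rewrite limn_einf_lim.
apply: lime_le; first exact: is_cvg_einfs.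
apply: nearW => n; apply: (@le_trans _ _ (\int[mu]_v (f (n + N)%N v)%:E)).
  by apply: ereal_inf_lbound; exists n => /=.
by apply: fC; rewrite leq_addl.
Qed.

End Partition.

(** * The travel weight as a limit of finite-horizon weights *)

Section StoppedPath.
Context (R : realType) (d : nat) (x : site d).
Implicit Types (V : site d -> R) (s : nat -> site d).

(** The killing weight of a path if it hits [x] by time [n], and 0 otherwise; its
    recursion is that of [hit_weight] along a single path. *)
Fixpoint horizon_weight V n s : R :=
  if n is n'.+1 then
    if s 0%N == x then 1
    else expR (- V (s 0%N)) * horizon_weight V n' (fun j => s j.+1)
  else (s 0%N == x)%:R.

Lemma horizon_weight_ge0 V n s : 0 <= horizon_weight V n s.
Proof.
elim: n s => [|n IHn] s /=; first by rewrite ler0n.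
by case: ifP => // _; rewrite mulr_ge0 ?expR_ge0.
Qed.

Lemma horizon_weight_nd V n s : horizon_weight V n s <= horizon_weight V n.+1 s.
Proof.
elim: n s => [|n IHn] s.
  by rewrite /=; case: ifP => // _; rewrite mulr_ge0 ?expR_ge0 ?ler0n.
rewrite [leLHS]/= [leRHS]/=; case: ifP => // _.
by rewrite ler_pM2l ?expR_gt0// IHn.
Qed.

Lemma horizon_weight_hit V n s k : s k = x -> (forall j, (j < k)%N -> s j != x) ->
  horizon_weight V n s =
  if (k <= n)%N then expR (- \sum_(0 <= j < k) V (s j)) else 0.
Proof.
elim: n s k => [|n IHn] s [|k] sk sj /=.
- by rewrite sk eqxx big_geq// oppr0 expR0.
- by rewrite (negPf (sj 0%N _)).
- by rewrite sk eqxx big_geq// oppr0 expR0.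
- rewrite (negPf (sj 0%N _))// (IHn (fun j => s j.+1) k)//; last first.
    by move=> j jk; apply: sj.
  rewrite ltnS; case: ifP => _; last by rewrite mulr0.
  by rewrite big_nat_recl// opprD expRD.
Qed.

Lemma horizon_weight_miss V n s : (forall j, s j != x) -> horizon_weight V n s = 0.
Proof.
elim: n s => [|n IHn] s sj /=; first by rewrite (negPf (sj 0%N)).
by rewrite (negPf (sj 0%N)) IHn ?mulr0// => j; exact: sj.
Qed.

End StoppedPath.

Section RandomWalk.
Context (R : realType) (d : nat) (d_gt0 : (0 < d)%N).
Context (dW : measure_display) (W : measurableType dW).
Context (S : nat -> W -> site d) (Pw : site d -> probability W R).
Hypothesis SRW : simple_random_walk S Pw.
Context (x : site d).

Let mS k y : measurable [set v | S k v = y].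
Proof. exact: SRW.1. Qed.

Let path_event n (s : nat -> site d) :=
  [set v | forall k, (k <= n)%N -> S k v = s k].

Lemma path_event_measurable n s : measurable (path_event n s).
Proof.
elim: n => [|n IHn].
  rewrite (_ : path_event 0 s = [set v | S 0%N v = s 0%N])//.
  by apply/seteqP; split=> v /= H; [exact: H|case].
rewrite (_ : path_event n.+1 s =
  path_event n s `&` [set v | S n.+1 v = s n.+1]); first exact: measurableI.
apply/seteqP; split=> v /=.
  by move=> H; split; [move=> k kn; apply/H/ltnW|exact: H].
move=> [H1 H2] k; rewrite leq_eqVlt => /orP[/eqP -> //|]; exact: H1.
Qed.

Lemma horizon_weight_measurable (V : site d -> R) n i :
  measurable_fun setT (fun v => horizon_weight x V n (fun j => S (i + j) v)).
Proof.
elim: n i => [|n IHn] i /=.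
  exact: (measurable_fun_countable (fun y : site d => (y == x)%:R : R) (mS (i + 0))).
apply: measurable_fun_ifT => //.
  exact: (measurable_fun_countable (fun y => y == x) (mS (i + 0))).
apply: measurable_funM.
  exact: (measurable_fun_countable (fun y => expR (- V y)) (mS (i + 0))).
under eq_fun do under eq_fun do rewrite addnS -addSn.
exact: IHn.
Qed.

Let extend (n : nat) (s : nat -> site d) (k : direction d) : nat -> site d :=
  fun j => if (j <= n)%N then s j else s n + unit_step k.

Lemma path_event_extend u n s k :
  Pw u (path_event n.+1 (extend n s k)) =
  (Pw u (path_event n s) * ((2 * d)%:R^-1)%:E)%E.
Proof.
rewrite !(SRW.2 u) -EFinM; congr EFin.
rewrite big_ord_recr /= /extend leqnn ltnn !mulrA; congr (_ * _); last first.
  by rewrite /srw_step (addrC (s n)) addrK l1norm_unit_step eqxx.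
by congr (_ * _); apply: eq_bigr => j _; rewrite (ltnW (ltn_ord j)) ltn_ord.
Qed.

(** The Markov property in integrated form: after the cylinder event, the walk
    restarts from its last position.  Cutting the event along the next step
    reproduces the recursion of [hit_weight]. *)
Lemma integral_horizon_weight V u m n s :
  (\int[Pw u]_(v in path_event n s)
     (horizon_weight x V m (fun j => S (n + j) v))%:E =
   Pw u (path_event n s) * (hit_weight x m V (s n))%:E)%E.
Proof.
have mP := path_event_measurable.
elim: m n s => [|m IHm] n s.
  rewrite muleC; apply: integral_const_on => // v Hv /=.
  by rewrite addn0 Hv.
have [snx|snx] := eqVneq (s n) x.
  rewrite muleC; apply: integral_const_on => // v Hv /=.
  by rewrite snx eqxx addn0 Hv// snx eqxx.
rewrite (eq_integral (fun v => ((expR (- V (s n)))%:E *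
    (horizon_weight x V m (fun j => S (n.+1 + j) v))%:E)%E)); last first.
  move=> v; rewrite inE => Hv /=.
  rewrite addn0 Hv// (negPf snx) EFinM; congr (_ * (horizon_weight _ _ _ _)%:E)%E.
  by apply/funext => j; rewrite addnS addSn.
have mH := horizon_weight_measurable V m n.+1.
rewrite ge0_integralZl_EFin//; last 2 first.
- by move=> v _; rewrite lee_fin horizon_weight_ge0.
- exact/measurable_EFinP/measurable_funTS.
rewrite (@integral_partition _ _ _ (Pw u) (direction d) _
  (fun k => path_event n.+1 (extend n s k)))//.
- rewrite hit_weightS (negPf snx).
  under eq_bigr do rewrite IHm path_event_extend /extend ltnn -muleA -EFinM.
  have fP : Pw u (path_event n s) \is a fin_num by exact: fin_num_measure.
  rewrite -(fineK fP); under eq_bigr do rewrite -EFinM.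
  rewrite sumEFin -!EFinM; congr EFin; rewrite /average -!mulr_sumr; ring.
- move=> k v Hv j jn; rewrite Hv; first by rewrite /extend jn.
  exact: leqW.
- move=> k k' v Hk Hk'; apply: (@unit_step_inj d).
  apply: (addrI (s n)); have := Hk n.+1 (leqnn _).
  by rewrite (Hk' n.+1 (leqnn _)) /extend ltnn.
- under eq_bigr do rewrite path_event_extend.
  have fP : Pw u (path_event n s) \is a fin_num by exact: fin_num_measure.
  rewrite -(fineK fP); under eq_bigr do rewrite -EFinM.
  rewrite sumEFin sumr_const card_direction; congr EFin.
  rewrite -[LHS]mulr_natr -mulrA mulVf ?mulr1//.
  by rewrite pnatr_eq0 muln_eq0 -lt0n.
- exact/measurable_EFinP.
- by move=> v; rewrite lee_fin horizon_weight_ge0.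
Qed.

Lemma expectation_horizon_weight V n u :
  (\int[Pw u]_v (horizon_weight x V n (fun j => S j v))%:E =
   (hit_weight x n V u)%:E)%E.
Proof.
have P1 : Pw u (path_event 0 (fun=> u)) = 1%E.
  by rewrite (SRW.2 u) eqxx big_ord0 mulr1.
rewrite (@integral_full _ _ _ _ (path_event 0 (fun=> u)))//.
- by rewrite (integral_horizon_weight V u n 0) P1 mul1e.
- exact: path_event_measurable.
- by apply/measurable_EFinP; exact: (horizon_weight_measurable V n 0).
- by move=> v; rewrite lee_fin horizon_weight_ge0.
Qed.

Lemma killing_weight_cvg (w : Omega R d) (s : nat -> site d) :
  horizon_weight x (fun z => coordinate z w) n s @[n --> \oo] -->
  killing_weight w x s.
Proof.
rewrite /killing_weight /hitting_time; case: pselect => [hits|miss].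
  case: ex_minnP => k /eqP sk kmin; apply: cvg_near_cst.
  exists k => // n /= kn; rewrite (@horizon_weight_hit _ _ _ _ _ _ k)//.
    by rewrite kn.
  by move=> j jk; apply/negP => /kmin; rewrite leqNgt jk.
apply: cvg_near_cst; apply: nearW => n; apply: horizon_weight_miss => j.
by apply/negP => sj; apply: miss; exists j.
Qed.

Lemma travel_e_cvg (w : Omega R d) u :
  ((hit_weight x n (fun z => coordinate z w) u)%:E @[n --> \oo] -->
   travel_e S Pw w u x)%E.
Proof.
set V := fun z => coordinate z w.
rewrite /travel_e unlock.
have -> : (fun n => (hit_weight x n V u)%:E) = (fun n =>
    \int[Pw u]_v (horizon_weight x V n (fun j => S j v))%:E)%E.
  by apply/funext => n; rewrite expectation_horizon_weight.
have H v : ((horizon_weight x V n (fun j => S j v))%:E @[n --> \oo] -->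
    (killing_weight w x (fun k => S k v))%:E)%E.
  by apply: cvg_EFin; [exact: nearW|exact: killing_weight_cvg].
rewrite (eq_integral (fun v => limn (fun n =>
    (horizon_weight x V n (fun j => S j v))%:E))); last first.
  by move=> v _; apply/esym/cvg_lim.
apply: cvg_monotone_convergence => //.
- by move=> n; apply/measurable_EFinP; exact: (horizon_weight_measurable V n 0).
- by move=> n v _; rewrite lee_fin horizon_weight_ge0.
- move=> v _ m n mn; rewrite lee_fin.
  have /nondecreasing_seqP : forall n, horizon_weight x V n (fun j => S j v) <=
    horizon_weight x V n.+1 (fun j => S j v) by move=> k; exact: horizon_weight_nd.
  exact.
Qed.

End RandomWalk.

(** * Rounding the potential to finitely many levels *)

Section Environment.
Context (R : realType) (d : nat) (P : probability (Omega R d) R).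
Hypothesis iidP : iid_coordinates P.

Lemma coordinate_measurable z : measurable_fun setT (@coordinate R d z).
Proof.
move=> _ B mB; rewrite setTI; apply: sub_gen_smallest.
by exists z, B.
Qed.

Lemma coordinate_ge0 z (w : Omega R d) : 0 <= coordinate z w.
Proof. by rewrite /coordinate ge0. Qed.

Section Discretization.
Context (J : finType) (D : R -> J).
Hypothesis mD : forall j, measurable [set r | D r = j].

Definition level_prob (j : J) : R := fine (P [set w | D (coordinate 0 w) = j]).

(** Levels of probability zero are dropped, so that what holds for almost every
    potential holds at every level. *)
Definition level : finType := {j : J | 0 < level_prob j}.

Let mDc z j : measurable [set w : Omega R d | D (coordinate z w) = j].
Proof.
have := coordinate_measurable z measurableT (mD j); rewrite setTI; exact.
Qed.

Lemma level_prob_law z j :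
  coordinate_law P z [set r | D r = j] = (level_prob j)%:E.
Proof.
rewrite iidP.2// /level_prob fineK//; exact: fin_num_measure.
Qed.

Lemma level_prob_ge0 (i : level) : 0 <= level_prob (val i).
Proof. by rewrite ltW// (valP i). Qed.

Lemma sum_level (F : J -> R) :
  \sum_(i : level) level_prob (val i) * F (val i) = \sum_j level_prob j * F j.
Proof.
rewrite -(big_sub [pred j | 0 < level_prob j] (fun j => level_prob j * F j)).
rewrite [RHS](bigID [pred j | 0 < level_prob j])/= [X in _ + X]big1 ?addr0//.
move=> j; rewrite -leNgt => j0; suff -> : level_prob j = 0 by rewrite mul0r.
by apply/eqP; rewrite eq_le j0 fine_ge0.
Qed.

Lemma sum_level_prob : \sum_(i : level) level_prob (val i) = 1.
Proof.
have := sum_level (fun=> 1); under eq_bigr do rewrite mulr1; move=> ->.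
under eq_bigr do rewrite mulr1.
apply: EFin_inj; rewrite -sumEFin.
pose A (j : J) := [set w : Omega R d | D (coordinate 0 w) = j].
have mA j : measurable (A j) by exact: mDc.
have UT : \big[setU/set0]_(j <- index_enum J) A j = setT.
  apply/seteqP; split=> // w _.
  by rewrite (bigD1 (D (coordinate 0 w)))//=; left.
have := @ge0_integral_bigsetU _ _ _ P J A (cst 1%E) (index_enum J).
rewrite UT; cbv zeta; rewrite integral_cst// mul1e => H; rewrite -[RHS](probability_setT P) [RHS]H//.
- apply: eq_bigr => j _; rewrite integral_cst//; rewrite mul1e /level_prob fineK//.
  exact: fin_num_measure.
- exact: index_enum_uniq.
- by move=> i j _ _ [w [<- <-]].
Qed.

Let level_event (t : seq (site d)) (eta : site d -> level) :=
  [set w : Omega R d | forall z, z \in t -> D (coordinate z w) = val (eta z)].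

Lemma level_event_measurable t eta : measurable (level_event t eta).
Proof.
elim: t => [|z t IHt].
  by rewrite (_ : level_event [::] eta = setT)//; apply/seteqP; split.
rewrite (_ : level_event (z :: t) eta =
  [set w | D (coordinate z w) = val (eta z)] `&` level_event t eta).
  exact: measurableI.
apply/seteqP; split=> w /=.
  move=> H; split; first by apply: H; rewrite inE eqxx.
  by move=> y yt; apply: H; rewrite inE yt orbT.
by move=> [H1 H2] y; rewrite inE => /orP[/eqP ->//|]; exact: H2.
Qed.

Lemma level_event_prob t eta : uniq t ->
  P (level_event t eta) = (\prod_(z <- t) level_prob (val (eta z)))%:E.
Proof.
move=> ut.
have := iidP.1 t (fun z => [set r | D r = val (eta z)]) ut (fun z => mD _).
rewrite -/(level_event t eta) => ->.
rewrite (eq_bigr (fun z => (level_prob (val (eta z)))%:E)).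
  by rewrite prodEFin.
by move=> z _; exact: level_prob_law.
Qed.

Let discretize (w : Omega R d) : site d -> J := fun z => D (coordinate z w).

(** Independence allows the coordinates to be integrated out one at a time,
    cutting the event along the level of the next site. *)
Lemma integral_level_event t r eta (F : (site d -> J) -> R) :
  uniq (t ++ r) ->
  (forall f g : site d -> J, (forall z, z \in t ++ r -> f z = g z) -> F f = F g) ->
  (forall f, 0 <= F f) -> measurable_fun setT (fun w => F (discretize w)) ->
  (\int[P]_(w in level_event t eta) (F (discretize w))%:E =
   P (level_event t eta) * (resample_seq (fun i : level => level_prob (val i)) r
     (fun f => F (fun z => val (f z))) eta)%:E)%E.
Proof.
move=> + + F0 mF; elim: r t eta => [|z r IHr] t eta utr Floc.
  rewrite muleC; apply: integral_const_on; first exact: level_event_measurable.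
  by move=> w Hw /=; congr EFin; apply: Floc => z; rewrite cats0 => /Hw.
have [zt [zr [ut ur]]] : z \notin t /\ z \notin r /\ uniq t /\ uniq r.
  move: utr; rewrite cat_uniq /= negb_or => /and3P[-> /andP[-> _] /andP[-> ->]].
  by [].
have utr' : uniq ((z :: t) ++ r) by rewrite -(uniq_catCA t [:: z] r).
pose B i := level_event (z :: t) (update eta z i).
have PB i : P (B i) = (level_prob (val i) *
    \prod_(y <- t) level_prob (val (eta y)))%:E.
  rewrite /B level_event_prob/= ?zt// big_cons update_same; congr (_ * _)%:E.
  apply: eq_big_seq => y yt; rewrite update_other//.
  by apply: contraNneq zt => <-.
have PA := level_event_prob eta ut.
rewrite (@integral_partition _ _ _ P level _ B).
- rewrite (_ : (P (level_event t eta) * _)%E = (\sum_(i : level)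
    P (B i) * (resample_seq (fun i : level => level_prob (val i)) r
     (fun f => F (fun z => val (f z))) (update eta z i))%:E)%E).
    apply: eq_bigr => i _; apply: IHr => // f g fg; apply: Floc => y.
    rewrite mem_cat inE => yy; apply: fg; rewrite mem_cat inE.
    by move: yy; do !case: (_ \in _); do !case: (_ == _).
  rewrite PA /= /resample -EFinM mulr_sumr -sumEFin; apply: eq_bigr => i _.
  by rewrite PB -EFinM; congr EFin; ring.
- exact: level_event_measurable.
- by move=> i; exact: level_event_measurable.
- move=> i w Hw y yt; rewrite Hw ?inE ?yt ?orbT// update_other//.
  by apply: contraNneq zt => <-.
- move=> i j w Hi Hj; apply: val_inj.
  by have := Hi z (mem_head _ _); rewrite (Hj z (mem_head _ _)) !update_same.
- under eq_bigr do rewrite PB.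
  by rewrite sumEFin -mulr_suml sum_level_prob mul1r PA.
- exact/measurable_EFinP.
- by move=> w; rewrite lee_fin.
Qed.

Theorem integral_discretize s (eta : site d -> level) (F : (site d -> J) -> R) :
  uniq s ->
  (forall f g : site d -> J, (forall z, z \in s -> f z = g z) -> F f = F g) ->
  (forall f, 0 <= F f) ->
  measurable_fun setT (fun w => F (fun z => D (coordinate z w))) ->
  (\int[P]_w (F (fun z => D (coordinate z w)))%:E =
   (resample_seq (fun i : level => level_prob (val i)) s
     (fun f => F (fun z => val (f z))) eta)%:E)%E.
Proof.
move=> us Floc F0 mF.
have E0 : level_event [::] eta = setT by apply/seteqP; split.
have := @integral_level_event [::] s eta F us Floc F0 mF.
rewrite E0 => ->; have := probability_setT P; move=> -> .
by rewrite mul1e.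
Qed.

End Discretization.
End Environment.

(** * A grid that approximates nonnegative reals from below *)

Section Grid.
Context (R : realType).
Implicit Types (k : nat) (r : R).

(** The multiples of [1 / k] up to [k]: both mesh and range improve with [k]. *)
Definition grid_index k r : 'I_(k * k).+1 :=
  inord (minn (k * k) (Num.truncn (k%:R * r))).

Definition grid_value k (j : 'I_(k * k).+1) : R := j%:R / k%:R.

Definition rounding k r : R := grid_value (grid_index k r).

Lemma grid_value_ge0 k (j : 'I_(k * k).+1) : 0 <= grid_value j.
Proof. by rewrite divr_ge0 ?ler0n. Qed.

Lemma roundingE k r :
  rounding k r = (minn (k * k) (Num.truncn (k%:R * r)))%:R / k%:R.
Proof. by rewrite /rounding /grid_value inordK// ltnS geq_minl. Qed.

Lemma grid_index_measurable k (j : 'I_(k * k).+1) :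
  measurable [set r | grid_index k r = j].
Proof.
rewrite (_ : [set r | _] = [set r | [set m | inord (minn (k * k) m) = j]
  (Num.truncn (k%:R * r))])//; apply: preimage_countable_measurable.
have mle m : measurable [set r : R | (Num.truncn (k%:R * r) <= m)%N].
  have -> : [set r | (Num.truncn (k%:R * r) <= m)%N] =
      (fun r : R => k%:R * r) @^-1` `]-oo, m.+1%:R[%classic.
    by apply/seteqP; split=> r /=; rewrite in_itv/= truncn_le_nat.
  rewrite -[X in measurable X]setTI.
  have mf : measurable_fun setT (fun r : R => k%:R * r).
    by apply: measurable_funM.
  exact: mf.
case=> [|m].
  rewrite (_ : [set r | _] = [set r | (Num.truncn (k%:R * r) <= 0)%N])//.
  by apply/seteqP; split=> r /=; rewrite leqn0 => /eqP.
rewrite (_ : [set r | _] = [set r | (Num.truncn (k%:R * r) <= m.+1)%N] `\`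
   [set r | (Num.truncn (k%:R * r) <= m)%N]); first exact: measurableD.
apply/seteqP; split=> r /=; first by move=> ->; rewrite ltnn.
by move=> [H1 /negP H2]; lia.
Qed.

Lemma rounding_ge0 k r : 0 <= rounding k r.
Proof. exact: grid_value_ge0. Qed.

Lemma rounding_le k r : 0 <= r -> rounding k r <= r.
Proof.
move=> r0; rewrite roundingE; case: k => [|k]; first by rewrite invr0 mulr0.
rewrite ler_pdivrMr ?ltr0n// [leRHS]mulrC.
apply: (@le_trans _ _ (Num.truncn (k.+1%:R * r))%:R).
  by rewrite ler_nat geq_minr.
by rewrite truncn_le mulr_ge0.
Qed.

Lemma rounding_ge k r : (0 < k)%N -> 0 <= r <= k%:R ->
  r - k%:R^-1 <= rounding k r.
Proof.
move=> k0 /andP[r0 rk]; have k0' : 0 < k%:R :> R by rewrite ltr0n.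
rewrite roundingE (minn_idPr _); last first.
  rewrite truncn_le_nat; apply: (@le_lt_trans _ _ (k * k)%:R).
    by rewrite natrM ler_wpM2l ?ler0n.
  by rewrite ltr_nat.
rewrite ler_pdivlMr// mulrBl mulVf ?gt_eqF// lerBlDr natr1 (mulrC r) ltW//.
exact: truncnS_gt.
Qed.

Lemma rounding_ge_half k (eps r : R) : 0 < eps -> eps <= r ->
  eps <= k%:R -> 2 / eps <= k%:R -> eps / 2 <= rounding k r.
Proof.
move=> e0 er ek ek2.
have k0' : 0 < k%:R :> R by lra.
have k0 : (0 < k)%N by move: k0'; rewrite ltr0n.
have [rk|rk] := leP r k%:R.
  have := @rounding_ge k r k0; rewrite rk andbT => /(_ _)/wrap[]; first lra.
  have : k%:R^-1 <= eps / 2.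
    by rewrite -[leRHS]invrK lef_pV2 ?posrE ?invr_gt0 ?divr_gt0// invf_div.
  lra.
rewrite roundingE (minn_idPl _); last first.
  rewrite truncn_ge_nat; last by rewrite mulr_ge0//; lra.
  by rewrite natrM ler_wpM2l ?ler0n// ltW.
rewrite natrM mulfK ?gt_eqF//; lra.
Qed.

Lemma rounding_cvg r : 0 <= r -> rounding k r @[k --> \oo] --> r.
Proof.
move=> r0.
apply/cvgrPdist_le => e e0; near=> k.
have k0 : (0 < k)%N by near: k; exists 1%N.
have rk : r <= k%:R by near: k; exact: nbhs_infty_ger.
have ek : e^-1 <= k%:R by near: k; exact: nbhs_infty_ger.
have H1 := rounding_le k r0; have := @rounding_ge k r k0.
rewrite r0 rk => /(_ isT) H2.
have H3 : k%:R^-1 <= e.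
  by rewrite -[leRHS]invrK lef_pV2 ?posrE ?invr_gt0 ?ltr0n.
rewrite ger0_norm; lra.
Unshelve. all: by end_near. Qed.

End Grid.

(** * The law of the rounded potential *)

Section PotentialLaw.
Context (R : realType) (d : nat) (P : probability (Omega R d) R).
Hypothesis iidP : iid_coordinates P.
Implicit Types (w : Omega R d) (k n m : nat) (z u : site d).

Local Notation coord z w := (@coordinate R d z w).

Let mcoord z : measurable_fun setT (@coordinate R d z).
Proof. exact: coordinate_measurable. Qed.

Let mge (e : R) : measurable [set w | e <= coord 0 w].
Proof.
have := mcoord 0 measurableT (measurable_itv `[e, +oo[); rewrite setTI.
by congr measurable; apply/seteqP; split=> w /=; rewrite in_itv/= andbT.
Qed.

(** Otherwise [coordinate 0] would be almost surely below each [1 / n]. *)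
Lemma positive_level :
  ~ (\forall w \ae P, coord 0 w = 0) ->
  exists2 e : R, 0 < e & (0 < P [set w | (e <= coord 0 w)%R])%E.
Proof.
move=> nontriv; apply: contrapT => H; apply: nontriv.
rewrite /almost_everywhere.
have : P.-negligible (\bigcup_n [set w | n.+1%:R^-1 <= coord 0 w]).
  apply: negligible_bigcup => n; exists [set w | n.+1%:R^-1 <= coord 0 w].
  split=> //; apply/eqP; rewrite -measure_le0 leNgt; apply/negP => H1.
  by apply: H; exists n.+1%:R^-1; rewrite ?invr_gt0.
apply: negligibleS => w /= H0.
have c0 : 0 < coord 0 w.
  by rewrite lt_neqAle coordinate_ge0 andbT eq_sym; apply/eqP.
exists (Num.truncn (coord 0 w)^-1) => //=.
rewrite -[leRHS]invrK lef_pV2 ?posrE ?invr_gt0 ?ltr0n//.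
exact/ltW/truncnS_gt.
Qed.

Lemma level_below_support :
  closed_support (coordinate_law P 0) `<=` [set r | 0 < r] ->
  exists2 e : R, 0 < e & P [set w | coord 0 w < e] = 0%E.
Proof.
move=> supp.
have : ~ closed_support (coordinate_law P 0) 0 by move=> /supp /=; rewrite ltxx.
move=> /existsNP[U /not_implyP[oU /not_implyP[U0 /negP]]].
rewrite -leNgt measure_le0 => /eqP PU.
have [e /= e0 eU] : exists2 e : R, 0 < e & ball 0 e `<=` U.
  have /nbhs_ballP[e e0 eU] := open_nbhs_nbhs (conj oU U0).
  by exists e.
exists e => //; apply/eqP; rewrite -measure_le0 -PU /coordinate_law /pushforward.
apply: le_measure; rewrite ?inE.
- rewrite (_ : [set w | _] = ~` [set w | e <= coord 0 w]); first exact: measurableC.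
  by apply/seteqP; split=> w /=; [move=> ce; apply/negP; rewrite -ltNge
    |move/negP; rewrite -ltNge].
- have := mcoord 0 measurableT (open_measurable oU); rewrite setTI; exact.
- move=> w /= ce; apply: eU; rewrite /ball/= sub0r normrN ger0_norm//.
  exact: coordinate_ge0.
Qed.

(** A level has positive probability, hence is attained off every null event. *)
Lemma level_prob_exists k (i : level P (grid_index k)) :
  forall Q : set (Omega R d), measurable Q -> P Q = 0%E ->
  exists2 w, ~ Q w & grid_index k (coord 0 w) = val i.
Proof.
move=> Q mQ PQ; apply: contrapT => H.
have := valP i; rewrite /level_prob.
rewrite (_ : P _ = 0%E) ?ltxx//.
have mA : measurable [set w | grid_index k (coord 0 w) = val i].
  have := mcoord 0 measurableT (grid_index_measurable (val i)).
  by rewrite setTI; exact.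
apply: (subset_measure0 mA mQ _ PQ) => w /= Hw.
by apply: contrapT => nQ; apply: H; exists w.
Qed.

Lemma measurable_rounding k : measurable_fun setT (rounding k : R -> R).
Proof.
move=> _ Y mY; rewrite setTI.
have H := preimage_countable_measurable (@grid_index_measurable R k).
have := H [set j | Y (grid_value R j)].
exact.
Qed.

Lemma integral_rounding_one k (F : R -> R) : measurable_fun setT F ->
  (forall r, 0 <= F r) ->
  (\int[P]_w (F (rounding k (coord 0 w)))%:E =
   (\sum_(i : level P (grid_index k)) level_prob P (grid_index k) (val i) *
     F (grid_value R (val i)))%:E)%E.
Proof.
move=> mF F0; set D : R -> _ := grid_index k.
have [i0] : exists i : level P D, True.
  apply: contrapT => H; have := @sum_level_prob R d P _ D (@grid_index_measurable R k).
  by rewrite big1 => [/eqP|i]; [rewrite eq_sym oner_eq0|case: H; exists i].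
move=> _.
have := @integral_discretize R d P iidP _ D (@grid_index_measurable R k) [:: 0]
  (fun=> i0) (fun f => F (grid_value R (f 0))).
move=> ->//.
- congr EFin; rewrite /= /resample; apply: eq_bigr => i _.
  by rewrite update_same.
- by move=> f g fg; rewrite fg// inE.
- apply: (measurableT_comp mF).
  exact: (measurableT_comp (measurable_rounding k) (mcoord 0)).
Qed.

Lemma second_moment_level k (m2 : R) :
  (\int[P]_w (coord 0 w ^+ 2)%:E <= m2%:E)%E ->
  \sum_(i : level P (grid_index k)) level_prob P (grid_index k) (val i) *
     grid_value R (val i) ^+ 2 <= m2.
Proof.
move=> H; rewrite -lee_fin -(integral_rounding_one k (F := fun r => r ^+ 2))//.
- apply: le_trans H; apply: ge0_le_integral => //.
  + by move=> w _; rewrite lee_fin sqr_ge0.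
  + apply/measurable_EFinP; apply: measurable_funX.
    exact: (measurableT_comp (measurable_rounding k) (mcoord 0)).
  + by apply/measurable_EFinP; apply: measurable_funX.
  + move=> w _; rewrite lee_fin lerXn2r ?nnegrE ?coordinate_ge0 ?rounding_ge0//.
    by rewrite rounding_le// coordinate_ge0.
- by move=> r; exact: sqr_ge0.
Qed.

Lemma laplace_level k (e : R) : 0 < e -> e <= k%:R -> 2 / e <= k%:R ->
  \sum_(i : level P (grid_index k)) level_prob P (grid_index k) (val i) *
     expR (- grid_value R (val i)) <=
  1 - (1 - expR (- (e / 2))) * fine (P [set w | e <= coord 0 w]).
Proof.
move=> e0 ek ek2; set A := [set w | e <= coord 0 w].
have mI : measurable_fun setT (\1_A : _ -> R).
  by apply: measurable_indic; exact: mge.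
have fA : P A \is a fin_num by apply: fin_num_measure; exact: mge.
set c := 1 - expR _.
have c0 : 0 <= c by rewrite subr_ge0 expR_le1 oppr_le0 divr_ge0// ltW.
have mN : measurable_fun setT (fun r : R => expR (- r)) by apply: measurableT_comp.
have mr : measurable_fun setT (fun w => expR (- rounding k (coord 0 w))).
  apply: (measurableT_comp mN).
  exact: (measurableT_comp (measurable_rounding k) (mcoord 0)).
rewrite lerBrDr -lee_fin EFinD.
rewrite -(integral_rounding_one k (F := fun r => expR (- r))); last 2 first.
- exact: mN.
- by move=> r; exact: expR_ge0.
have -> : (c * fine (P A))%:E = (\int[P]_w (c%:E * (\1_A w)%:E))%E.
  rewrite ge0_integralZl_EFin//; last exact/measurable_EFinP.
  by rewrite integral_indic ?setIT ?EFinM ?fineK//; exact: mge.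
rewrite -ge0_integralD//.
- rewrite -(probability_setT P) -[leRHS]mul1e -(integral_cst P measurableT).
  apply: ge0_le_integral => //.
  + by move=> w _; rewrite adde_ge0// -EFinM lee_fin mulr_ge0.
  + apply: emeasurable_funD; first exact/measurable_EFinP.
    by apply/measurable_EFinP/measurable_funM.
  + move=> w _; rewrite /cst -EFinM -EFinD lee_fin indicE.
    have r0 : 0 <= rounding k (coord 0 w) := rounding_ge0 _ _.
    have [wA|wA] := boolP (w \in A).
      rewrite mulr1 /c -lerBrDr opprB addrCA subrr addr0 ler_expR lerN2.
      by apply: rounding_ge_half => //; move: wA; rewrite inE.
    by rewrite mulr0 addr0 expR_le1 oppr_le0.
- exact/measurable_EFinP.
- by move=> w _; rewrite -EFinM lee_fin mulr_ge0.
- by apply/measurable_EFinP/measurable_funM.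
Qed.

End PotentialLaw.

(** * From the finite model to the travel cost *)

Section TravelCostConcentration.
Context (R : realType) (d : nat) (d_ge2 : (2 <= d)%N).
Context (P : probability (Omega R d) R) (iidP : iid_coordinates P).
Implicit Types (w : Omega R d) (k n m : nat) (z u x : site d).

Let d_gt0 : (0 < d)%N. Proof. exact: leq_trans d_ge2. Qed.

Local Notation coord z w := (@coordinate R d z w).
Local Notation lev k := (level P (@grid_index R k)).
Local Notation law k := (fun i : lev k => level_prob P (@grid_index R k) (val i)).
Local Notation val_of k := (fun i : lev k => grid_value R (val i)).

Lemma hit_prob_le1 z m u : hit_prob R z m u <= 1.
Proof.
elim: m u => [|m IHm] u; first by rewrite /=; case: eqP.
rewrite hit_probS; case: ifP => // _.
by rewrite -[leRHS](average_cst 1 u d_gt0); exact: average_le.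
Qed.

(** The hypotheses of the finite model, with constants that do not depend on the
    mesh: a new site has weight at most [expR (- c)] on average, and each return to
    a site has weight at most [1 - kappa]. *)
Definition good_levels (c kappa : R) k :=
  \sum_(i : lev k) law k i * expR (c - val_of k i) <= 1 /\
  forall (i : lev k) z m,
    expR (- val_of k i) * average (hit_prob R z m) z <= 1 - kappa.

(** [c] comes from a value reached by [omega 0] with positive probability;
    [kappa] bounds the escape probability of the walk if [d >= 3], and comes from
    the lower bound on the potential if [d = 2]. *)
Lemma exists_good_levels :
  ~ (\forall w \ae P, coord 0 w = 0) ->
  (d = 2%N -> closed_support (coordinate_law P 0) `<=` [set r | 0 < r]) ->
  exists c kappa : R, [/\ 0 < c, 0 < kappa &
    exists k0, forall k, (k0 <= k)%N -> good_levels c kappa k].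
Proof.
move=> nontriv supp.
have [e1 e10 Pe1] := positive_level nontriv.
set A := [set w | e1 <= coord 0 w] in Pe1.
have mA : measurable A.
  have := @coordinate_measurable R d 0 measurableT _ (measurable_itv `[e1, +oo[).
  rewrite setTI.
  by congr measurable; apply/seteqP; split=> w /=; rewrite in_itv/= andbT.
have fA : P A \is a fin_num by exact: fin_num_measure.
pose delta := (1 - expR (- (e1 / 2))) * fine (P A).
have e1h : 0 < 1 - expR (- (e1 / 2)) by rewrite subr_gt0 expR_lt1 oppr_lt0 divr_gt0.
have PA0 : 0 < fine (P A) by rewrite fine_gt0// Pe1 ltey_eq fA.
have PA1 : fine (P A) <= 1.
  by rewrite -lee_fin fineK// probability_le1.
have delta0 : 0 < delta by exact: mulr_gt0.
have delta1 : delta < 1.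
  apply: (@le_lt_trans _ _ (1 - expR (- (e1 / 2)))); last first.
    by rewrite ltrBlDr ltrDl expR_gt0.
  by rewrite ler_piMr// ltW.
pose c := - ln (1 - delta).
have c0 : 0 < c by rewrite oppr_gt0 ln_lt0//; lra.
have laplace k : e1 <= k%:R -> 2 / e1 <= k%:R ->
    \sum_(i : lev k) law k i * expR (c - val_of k i) <= 1.
  move=> ek ek2.
  under eq_bigr do rewrite expRD mulrCA.
  rewrite -mulr_sumr /c expRN lnK ?posrE ?subr_gt0//.
  rewrite ler_pdivrMl ?subr_gt0// mulr1.
  exact: laplace_level.
have [d3|d3] := leqP 3 d.
  have [rho rho1 Hrho] := @transience R d d3.
  exists c, (1 - rho); split => //; first by rewrite subr_gt0.
  exists (Num.truncn (e1 + 2 / e1)).+1 => k kk.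
  have ek : e1 + 2 / e1 <= k%:R.
    apply: (le_trans (ltW (truncnS_gt _))); by rewrite ler_nat.
  have e20 : 0 < 2 / e1 by rewrite divr_gt0.
  split; first by apply: laplace; lra.
  move=> i z m; rewrite opprB addrCA subrr addr0.
  apply: (le_trans _ (Hrho z m)); rewrite ler_piMl//.
    by apply: average_ge0 => y; exact: hit_prob_ge0.
  by rewrite expR_le1 oppr_le0 grid_value_ge0.
have d2 : d = 2%N by apply/eqP; rewrite eqn_leq -ltnS d3.
have [e2 e20 Pe2] := level_below_support (supp d2).
exists c, (1 - expR (- (e2 / 2))); split => //.
  by rewrite subr_gt0 expR_lt1 oppr_lt0 divr_gt0.
exists (Num.truncn (e1 + 2 / e1 + (e2 + 2 / e2))).+1 => k kk.
have ek : e1 + 2 / e1 + (e2 + 2 / e2) <= k%:R.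
  apply: (le_trans (ltW (truncnS_gt _))); by rewrite ler_nat.
have h1 : 0 < 2 / e1 by rewrite divr_gt0.
have h2 : 0 < 2 / e2 by rewrite divr_gt0.
split; first by apply: laplace; lra.
move=> i z m; rewrite opprB addrCA subrr addr0.
have mB : measurable [set w | coord 0 w < e2].
  have := @coordinate_measurable R d 0 measurableT _ (measurable_itv `]-oo, e2[).
  rewrite setTI.
  by congr measurable; apply/seteqP; split=> w /=; rewrite in_itv.
have [w nw wi] := level_prob_exists i mB Pe2.
have vi : e2 / 2 <= val_of k i.
  rewrite -wi -/(rounding k (coord 0 w)); apply: rounding_ge_half => //; try lra.
  by move/negP: nw; rewrite -leNgt.
rewrite -[leRHS]mulr1; apply: ler_pM; rewrite ?expR_ge0//.
- by apply: average_ge0 => y; exact: hit_prob_ge0.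
- by rewrite ler_expR lerN2.
- rewrite -[leRHS](average_cst 1 z d_gt0); apply: average_le => y.
  exact: hit_prob_le1.
Qed.

Lemma measurable_hit_weight x n u (V : site d -> Omega R d -> R) :
  (forall z, measurable_fun setT (V z)) ->
  measurable_fun setT (fun w => hit_weight x n (fun z => V z w) u).
Proof.
move=> mV; elim: n u => [|n IHn] u; first exact: measurable_cst.
rewrite /=; case: (u == x); first exact: measurable_cst.
apply: measurable_funM; first by do 2 apply: measurableT_comp => //.
apply: measurable_funM; first exact: measurable_cst.
by apply: measurable_sum => i; exact: IHn.
Qed.

Lemma measurable_cost x n u (V : site d -> Omega R d -> R) :
  (forall z, measurable_fun setT (V z)) ->
  measurable_fun setT (fun w => cost x n (fun z => V z w) u).
Proof.
move=> mV; apply: measurableT_comp => //; apply: measurableT_comp => //.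
exact: measurable_hit_weight.
Qed.

Lemma hit_weight_cvg x n u (V : nat -> site d -> R) (W : site d -> R) :
  (forall z, V k z @[k --> \oo] --> W z) ->
  hit_weight x n (V k) u @[k --> \oo] --> hit_weight x n W u.
Proof.
move=> VW; elim: n u => [|n IHn] u; first exact: cvg_cst.
rewrite /=; case: (u == x); first exact: cvg_cst.
apply: cvgM.
  apply: continuous_cvg; first exact: continuous_expR.
  by apply: cvgN.
apply: cvgM; first exact: cvg_cst.
apply: cvg_big => [|i _]; [exact: add_continuous|exact: IHn].
Qed.

Lemma cost_cvg x n u (V : nat -> site d -> R) (W : site d -> R) :
  (l1norm (x - u) <= n)%N -> (forall z, V k z @[k --> \oo] --> W z) ->
  cost x n (V k) u @[k --> \oo] --> cost x n W u.
Proof.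
move=> lun VW; apply: cvgN.
apply: continuous_cvg; last exact: hit_weight_cvg.
by apply: continuous_ln; exact: hit_weight_gt0.
Qed.

Context (m2 c kappa : R).
Hypothesis moment : (\int[P]_w (coord 0 w ^+ 2)%:E <= m2%:E)%E.
Hypotheses (c_gt0 : 0 < c) (kappa_gt0 : 0 < kappa).
Context (k0 : nat).
Hypothesis good : forall k, (k0 <= k)%N -> good_levels c kappa k.

Let K := m2 / (kappa ^+ 2 * c).
Let M x := (l1norm x)%:R * (1 + m2 + ln (2 * d)%:R).
Let rounded k w : site d -> R := fun z => rounding k (coord z w).
Let potential w : site d -> R := fun z => coord z w.

Let mrounded k z : measurable_fun setT (fun w => rounded k w z).
Proof.
apply: (measurableT_comp (measurable_rounding k)).
exact: coordinate_measurable.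
Qed.

Let rounded_ge0 k w z : 0 <= rounded k w z.
Proof. exact: rounding_ge0. Qed.

Lemma rounded_log_laplace x n k mu : (l1norm x <= n)%N -> (k0 <= k)%N ->
  0 <= mu -> K * mu ^+ 2 <= 1 / 2 ->
  exists A : R, [/\ (\int[P]_w (cost x n (rounded k w) 0)%:E = A%:E)%E,
    A <= M x &
    (\int[P]_w (expR (- mu * cost x n (rounded k w) 0))%:E <=
      (expR (- mu * A + 4 * K * M x * mu ^+ 2))%:E)%E].
Proof.
move=> xn kk mu0 Kmu; have [Hc Hk] := good kk.
have mD := @grid_index_measurable R k.
have psum := @sum_level_prob R d P _ _ mD.
have [i0] : exists i : lev k, True.
  apply: contrapT => H; move: psum.
  by rewrite big1 => [/eqP|i]; [rewrite eq_sym oner_eq0|case: H; exists i].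
move=> _.
have := @cost_log_laplace R d d_gt0 x (lev k) (law k) (val_of k)
  (@level_prob_ge0 R d P _ (@grid_index R k)) psum
  (fun i => grid_value_ge0 _ _) m2 c kappa (second_moment_level iidP k moment)
  c_gt0 Hc kappa_gt0 Hk n xn (fun=> i0) mu mu0 Kmu.
set s := undup _; rewrite -/K -/(M x).
have us : uniq s := undup_uniq _.
have Ecost (h : R -> R) : measurable_fun setT h -> (forall r, 0 <= r -> 0 <= h r) ->
    (\int[P]_w (h (cost x n (rounded k w) 0))%:E = (resample_seq (law k) s
      (fun f => h (cost x n (fun z => val_of k (f z)) 0)) (fun=> i0))%:E)%E.
  move=> mh h0.
  rewrite -(@integral_discretize R d P iidP _ (@grid_index R k) mD s (fun=> i0)
    (fun f => h (cost x n (fun z => grid_value R (f z)) 0)))//.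
  - move=> f g fg; congr (h (- ln _)); apply: hit_weight_local => y yr.
    by rewrite fg// mem_undup.
  - by move=> f; apply: h0; apply: cost_ge0 => // y; exact: grid_value_ge0.
  - apply: (measurableT_comp mh).
    exact: (@measurable_cost x n 0 (fun z w => rounded k w z) (mrounded k)).
move=> [EM Elap]; exists (resample_seq (law k) s
  (fun f => cost x n (fun z => val_of k (f z)) 0) (fun=> i0)); split=> //.
  exact: (Ecost idfun (@measurable_id _ _ _) (fun r r0 => r0)).
rewrite (Ecost (fun r => expR (- mu * r)))//.
by apply: measurableT_comp => //; apply: measurable_funM.
Qed.

Let rounded_le k w z : rounded k w z <= potential w z.
Proof. by apply: rounding_le; exact: coordinate_ge0. Qed.

Let potential_ge0 w z : 0 <= potential w z.
Proof. exact: coordinate_ge0. Qed.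

Let rounded_cvg w z : rounded k w z @[k --> \oo] --> potential w z.
Proof. by apply: rounding_cvg; exact: coordinate_ge0. Qed.

Let mcost_rounded x n k :
  measurable_fun setT (fun w => cost x n (rounded k w) 0).
Proof. exact: (@measurable_cost x n 0 (fun z w => rounded k w z)). Qed.

Let mcost_potential x n : measurable_fun setT (fun w => cost x n (potential w) 0).
Proof.
exact: (@measurable_cost x n 0 (fun z w => coord z w) (@coordinate_measurable R d)).
Qed.

Let measurable_expM (mu : R) (f : Omega R d -> R) : measurable_fun setT f ->
  measurable_fun setT (fun w => expR (- mu * f w)).
Proof. by move=> mf; apply: measurableT_comp => //; exact: measurable_funM. Qed.

(** As the mesh shrinks, Fatou's lemma bounds the mean cost of the true potential
    by any bound valid for the rounded ones.  One such bound is the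
    log-Laplace inequality solved for the mean, whose other side is taken at
    the true potential because rounding down lowers the cost. *)
Lemma cost_log_laplace_limit x n mu : (l1norm x <= n)%N ->
  0 < mu -> K * mu ^+ 2 <= 1 / 2 ->
  exists A : R, [/\ (\int[P]_w (cost x n (potential w) 0)%:E = A%:E)%E,
    A <= M x &
    (\int[P]_w (expR (- mu * cost x n (potential w) 0))%:E <=
      (expR (- mu * A + 4 * K * M x * mu ^+ 2))%:E)%E].
Proof.
move=> xn mu0 Kmu; have x0n : (l1norm (x - 0) <= n)%N by rewrite subr0.
have bound (B : R) : (forall k, (k0 <= k)%N ->
    (\int[P]_w (cost x n (rounded k w) 0)%:E <= B%:E)%E) ->
    (\int[P]_w (cost x n (potential w) 0)%:E <= B%:E)%E.
  apply: (fatou_le (f := fun k w => cost x n (rounded k w) 0)).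
  - by move=> k; exact: mcost_rounded.
  - by move=> k w; exact: cost_ge0.
  - by move=> w; apply: cost_cvg => //; exact: rounded_cvg.
have EM : (\int[P]_w (cost x n (potential w) 0)%:E <= (M x)%:E)%E.
  apply: bound => k kk.
  by have [A [-> AM _]] := rounded_log_laplace xn kk (ltW mu0) Kmu.
have E0 : (0 <= \int[P]_w (cost x n (potential w) 0)%:E)%E.
  by apply: integral_ge0 => w _; rewrite lee_fin cost_ge0.
have Efin : (\int[P]_w (cost x n (potential w) 0)%:E)%E \is a fin_num.
  by rewrite ge0_fin_numE// (le_lt_trans EM)// ltry.
exists (fine (\int[P]_w (cost x n (potential w) 0)%:E)%E).
rewrite fineK//; split => //; first by rewrite -lee_fin fineK.
set L := (\int[P]_w (expR _)%:E)%E.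
set B := 4 * K * M x * mu ^+ 2.
have L0 : (0 <= L)%E by apply: integral_ge0 => w _; rewrite lee_fin expR_ge0.
have LA k : (k0 <= k)%N -> exists A : R,
    (\int[P]_w (cost x n (rounded k w) 0)%:E = A%:E)%E /\
    (L <= (expR (- mu * A + B))%:E)%E.
  move=> kk; have [A [EA _ HA]] := rounded_log_laplace xn kk (ltW mu0) Kmu.
  exists A; split=> //; apply: (le_trans _ HA); apply: ge0_le_integral => //.
  - by apply/measurable_EFinP; exact: measurable_expM.
  - by apply/measurable_EFinP; exact: measurable_expM.
  - move=> w _; rewrite lee_fin ler_expR !mulNr lerN2 ler_pM2l//.
    exact: cost_anti.
have Lfin : L \is a fin_num.
  have [A [_ HL]] := LA k0 (leqnn _).
  by rewrite ge0_fin_numE// (le_lt_trans HL)// ltry.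
move: L0 LA; rewrite -(fineK Lfin) !lee_fin; set l := fine L => l0 LA.
have [l_le0|l_gt0] := leP l 0.
  by rewrite (le_trans l_le0)// expR_ge0.
rewrite -[leLHS]lnK ?posrE// ler_expR.
suff : fine (\int[P]_w (cost x n (potential w) 0)%:E)%E <= (B - ln l) / mu.
  by rewrite ler_pdivlMr//; lra.
rewrite -lee_fin fineK//; apply: bound => k /LA[A [-> HA]].
rewrite lee_fin ler_pdivlMr//.
by move: HA; rewrite lee_fin -[leLHS]lnK ?posrE// ler_expR; lra.
Qed.

Context (dW : measure_display) (W : measurableType dW).
Context (S : nat -> W -> site d) (Pw : site d -> probability W R).
Hypothesis SRW : simple_random_walk S Pw.

Lemma travel_cost_limit x w : exists a : R,
  [/\ travel_cost S Pw w 0 x = a%:E, 0 <= a,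
     forall n, (l1norm x <= n)%N -> a <= cost x n (potential w) 0 &
     cost x n (potential w) 0 @[n --> \oo] --> a].
Proof.
pose h n := hit_weight x n (potential w) 0.
have h_nd : nondecreasing_seq h.
  by apply/nondecreasing_seqP => n; exact: hit_weight_nd.
have h1 n : h n <= 1 by exact: hit_weight_le1.
have hcvg : cvgn h.
  by apply: nondecreasing_is_cvgn => //; exists 1 => _ [n _ <-].
set e := limn h in hcvg.
have he : h n @[n --> \oo] --> e := hcvg.
have hle n : h n <= e by exact: nondecreasing_cvgn_le.
have h0 n : (l1norm x <= n)%N -> 0 < h n.
  by move=> xn; apply: hit_weight_gt0 => //; rewrite subr0.
have e0 : 0 < e := lt_le_trans (h0 _ (leqnn _)) (hle _).
have e1 : e <= 1 by apply: limr_le => //; exact: nearW.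
have te : travel_e S Pw w 0 x = e%:E.
  have H := @travel_e_cvg R d d_gt0 dW W S Pw SRW x w 0.
  rewrite -(cvg_lim _ H)//; apply/cvg_lim => //.
  by apply: cvg_EFin => //; exact: nearW.
exists (- ln e); split.
- by rewrite /travel_cost te lne_EFin.
- by rewrite oppr_ge0 ln_le0.
- move=> n xn; rewrite /cost lerN2 -/(h n) ler_ln ?posrE//; exact: h0.
- apply: cvgN; apply: continuous_cvg => //; exact: continuous_ln.
Qed.

(** Chernoff's bound.  The horizon tends to infinity by Fatou's lemma for
    [expR (- mu * cost)]; the mean needs no limit, since a finite horizon only
    increases the cost. *)
Lemma travel_cost_lower_tail x t mu : 0 < mu -> K * mu ^+ 2 <= 1 / 2 ->
  [/\ (0 <= \int[P]_u travel_cost S Pw u 0 x <= (M x)%:E)%E,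
     (forall w, 0 <= travel_cost S Pw w 0 x)%E,
     measurable [set w | (travel_cost S Pw w 0 x
       - \int[P]_u travel_cost S Pw u 0 x <= (- t)%:E)%E] &
  (P [set w | travel_cost S Pw w 0 x - \int[P]_u travel_cost S Pw u 0 x
      <= (- t)%:E] <= (expR (- mu * t + 4 * K * M x * mu ^+ 2))%:E)%E].
Proof.
move=> mu0 Kmu.
have [a Ha] := choice (travel_cost_limit x).
have aE w : travel_cost S Pw w 0 x = (a w)%:E by have [] := Ha w.
have a0 w : 0 <= a w by have [] := Ha w.
have acost n w : (l1norm x <= n)%N -> a w <= cost x n (potential w) 0.
  by have [_ _ H _] := Ha w; exact: H.
have acvg w : cost x n (potential w) 0 @[n --> \oo] --> a w by have [] := Ha w.
have ma : measurable_fun setT a.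
  apply: (measurable_fun_cvg (h := fun n w => cost x n (potential w) 0)).
    by move=> n; exact: mcost_potential.
  by move=> w _; exact: acvg.
rewrite (eq_integral (fun w => (a w)%:E)); last by move=> w _.
have alim n : (l1norm x <= n)%N ->
    (\int[P]_w (a w)%:E <= \int[P]_w (cost x n (potential w) 0)%:E)%E.
  move=> xn; apply: ge0_le_integral => //.
  - by move=> w _; rewrite lee_fin.
  - exact/measurable_EFinP.
  - by apply/measurable_EFinP; exact: mcost_potential.
  - by move=> w _; rewrite lee_fin acost.
have I0 : (0 <= \int[P]_w (a w)%:E)%E.
  by apply: integral_ge0 => w _; rewrite lee_fin.
have IM : (\int[P]_w (a w)%:E <= (M x)%:E)%E.
  apply: (le_trans (alim _ (leqnn _))).
  by have [A [-> AM _]] := cost_log_laplace_limit (leqnn (l1norm x)) mu0 Kmu.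
have Ifin : (\int[P]_w (a w)%:E)%E \is a fin_num.
  by rewrite ge0_fin_numE// (le_lt_trans IM)// ltry.
move: alim I0 IM; rewrite -(fineK Ifin); set abar := fine _ => alim I0 IM.
rewrite (_ : [set w | _] = [set w | a w <= abar - t]); last first.
  apply/seteqP; split=> w /=; rewrite aE -EFinB lee_fin; lra.
set E := [set w | _].
have mE : measurable E.
  have := ma measurableT _ (measurable_itv `]-oo, abar - t]); rewrite setTI.
  by congr measurable; apply/seteqP; split=> w /=; rewrite in_itv.
split=> //; first by rewrite I0.
  by move=> w; rewrite aE lee_fin.
set B := 4 * K * M x * mu ^+ 2.
have laplace : (\int[P]_w (expR (- mu * a w))%:E <= (expR (- mu * abar + B))%:E)%E.
  apply: (fatou_le (N := l1norm x)
    (f := fun n w => expR (- mu * cost x n (potential w) 0))).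
  - by move=> n; apply: measurable_expM; exact: mcost_potential.
  - by move=> n w; exact: expR_ge0.
  - move=> w; apply: continuous_cvg; first exact: continuous_expR.
    by apply: cvgM; [exact: cvg_cst|exact: acvg].
  - move=> n xn; have [A [EA _ HA]] := cost_log_laplace_limit xn mu0 Kmu.
    apply: (le_trans HA); rewrite lee_fin ler_expR lerD2r !mulNr lerN2 ler_pM2l//.
    by rewrite -lee_fin -EA; exact: alim.
rewrite -[leLHS]mul1e -(integral_cst P mE).
apply: (@le_trans _ _ (\int[P]_(w in E)
    ((expR (mu * (abar - t)))%:E * (expR (- mu * a w))%:E))%E).
  apply: ge0_le_integral => //.
  - by apply/measurable_EFinP/measurable_funTS/measurable_funM => //; exact: measurable_expM.
  - move=> w Ew; rewrite /cst -EFinM lee_fin -expRD -[X in X <= _]expR0 ler_expR.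
    by rewrite mulNr -mulrBr pmulr_rge0// subr_ge0.
apply: (@le_trans _ _ (\int[P]_w
    ((expR (mu * (abar - t)))%:E * (expR (- mu * a w))%:E))%E).
  apply: ge0_subset_integral => //.
  by apply/measurable_EFinP/measurable_funM => //; exact: measurable_expM.
rewrite ge0_integralZl_EFin ?expR_ge0//; last first.
  by apply/measurable_EFinP; exact: measurable_expM.
apply: (@le_trans _ _ ((expR (mu * (abar - t)))%:E * (expR (- mu * abar + B))%:E)%E).
  by rewrite lee_pmul2l// lte_fin expR_gt0.
by rewrite -EFinM lee_fin -expRD ler_expR; lra.
Qed.

End TravelCostConcentration.

Theorem theorem1p4 (R : realType) (d : nat) (d_ge2 : (2 <= d)%N)
    (dW : measure_display) (W : measurableType dW)
    (S : nat -> W -> site d) (Pw : site d -> probability W R)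
    (SRW : simple_random_walk S Pw)
    (P : probability (Omega R d) R)
    (iidP : iid_coordinates P)
    (nontrivial : ~ (\forall w \ae P, coordinate (0 : site d) w = 0))
    (moment2 : ('E_P[(fun w => coordinate (0 : site d) w ^+ 2)%R] < +oo)%E)
    (support2 : d = 2%N ->
       closed_support (coordinate_law P 0) `<=` [set r | 0 < r]) :
  exists C : R, 0 < C /\
    exists N : nat, forall x : site d, (N <= l1norm x)%N ->
      forall t : R, 0 <= t ->
        (P [set w | travel_cost S Pw w 0 x
                    - \int[P]_u travel_cost S Pw u 0 x
                    <= (- t * Num.sqrt (l1norm x)%:R)%:E]
         <= (expR (- C * t ^+ 2))%:E)%E.
Proof.
have [c [kappa [c0 kappa0 [k0 good]]]] :=
  exists_good_levels d_ge2 iidP nontrivial support2.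
pose E2 := (\int[P]_w (coordinate (0 : site d) w ^+ 2)%:E)%E.
have E20 : (0 <= E2)%E by apply: integral_ge0 => w _; rewrite lee_fin sqr_ge0.
have E2fin : E2 \is a fin_num.
  by rewrite ge0_fin_numE//; move: moment2; rewrite unlock.
pose m2 := fine E2.
have m20 : 0 <= m2 by exact: fine_ge0.
have Hm2 : (E2 <= m2%:E)%E by rewrite fineK.
pose K := m2 / (kappa ^+ 2 * c).
have K0 : 0 <= K by rewrite divr_ge0// mulr_ge0 ?sqr_ge0// ltW.
pose M := 1 + m2 + ln (2 * d)%:R : R.
have M0 : 0 < M.
  have : 0 <= ln (2 * d)%:R :> R.
    by rewrite ln_ge0// ler1n muln_gt0/= (leq_trans _ d_ge2).
  by rewrite /M; lra.
(* Both mu0 <= 1 and K * mu0 <= 1 / 2, hence K * mu ^ 2 <= 1 / 2 up to mu0. *)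
pose mu0 := (1 + 2 * K)^-1.
have mu00 : 0 < mu0 by rewrite invr_gt0; lra.
have mu01 : mu0 <= 1 by rewrite invf_le1; lra.
have Kmu0 : K * mu0 <= 1 / 2 by rewrite ler_pdivrMr; lra.
have Ksmall mu : 0 < mu <= mu0 -> K * mu ^+ 2 <= 1 / 2.
  move=> /andP[mu_gt0 mu_le]; apply: le_trans Kmu0; rewrite ler_wpM2l//.
  by rewrite expr2; nra.
(* The second summand makes L so large that the optimal mu stays below mu0 for
   each t at which the event is possible. *)
pose L := 4 * K * M + M / mu0.
have KM0 : 0 <= 4 * K * M by apply: mulr_ge0; [exact: mulr_ge0|exact: ltW].
have Mmu0 : 0 < M / mu0 by exact: divr_gt0.
have L0 : 0 < L by rewrite /L; lra.
exists (1 / (4 * L)); split; first by rewrite divr_gt0// mulr_gt0.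
exists 1%N => x l1 t t0.
set l : R := (l1norm x)%:R.
have l0 : 0 < l by rewrite ltr0n.
set r := Num.sqrt l; have r0 : 0 < r by rewrite sqrtr_gt0.
have r2 : r ^+ 2 = l by rewrite sqr_sqrtr// ltW.
have tail mu : 0 < mu <= mu0 -> _ := fun mu_bounds =>
  @travel_cost_lower_tail R d d_ge2 P iidP m2 c kappa Hm2 c0 kappa0 k0 good
    dW W S Pw SRW x (t * r) mu (proj1 (andP mu_bounds)) (Ksmall mu mu_bounds).
rewrite mulNr; have [|Ibounds tc0 mE _] := tail mu0; first by rewrite mu00 lexx.
have [te|tn0] := eqVneq t 0.
  by apply: (le_trans (probability_le1 P mE)); rewrite te expr0n/= mulr0 expR0.
have tgt0 : 0 < t by rewrite lt_def tn0.
have [tM|tM] := leP t (2 * M * r).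
  (* The minimiser of - mu * t * r + L * l * mu ^ 2. *)
  pose mu := t / (2 * L * r).
  have Lr0 : 0 < 2 * L * r by rewrite !mulr_gt0.
  have mu_gt0 : 0 < mu by exact: divr_gt0.
  have mu_le : mu <= mu0.
    rewrite ler_pdivrMr//; apply: (le_trans tM).
    rewrite mulrA ler_pM2r// mulrCA ler_pM2l//.
    have : M = mu0 * (M / mu0) by field; rewrite gt_eqF.
    move=> ->; rewrite ler_pM2l// /L; lra.
  have [|_ _ _] := tail mu; first by rewrite mu_gt0 mu_le.
  move=> /le_trans; apply; rewrite lee_fin ler_expR.
  have -> : - mu * (t * r) = - (t ^+ 2 / (2 * L)).
    by rewrite /mu; field; rewrite !gt_eqF.
  have -> : 4 * (m2 / (kappa ^+ 2 * c)) * ((l1norm x)%:R * (1 + m2 + ln (2 * d)%:R))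
      * mu ^+ 2 = 4 * K * M * (t ^+ 2 / (4 * L ^+ 2)).
    rewrite -/K -/M -/l -r2 /mu; field; rewrite !gt_eqF//.
  have : 4 * K * M * (t ^+ 2 / (4 * L ^+ 2)) <= L * (t ^+ 2 / (4 * L ^+ 2)).
    rewrite ler_wpM2r//; first by rewrite divr_ge0 ?sqr_ge0// mulr_ge0 ?sqr_ge0.
    by rewrite /L; lra.
  have -> : L * (t ^+ 2 / (4 * L ^+ 2)) = t ^+ 2 / (2 * L) - 1 / (4 * L) * t ^+ 2.
    by field; rewrite gt_eqF.
  lra.
(* The cost is nonnegative, so it cannot lie more than its mean below its mean. *)
rewrite (_ : [set w | _] = set0) ?measure0 ?lee_fin ?expR_ge0//.
apply/seteqP; split=> // w /=; have := tc0 w.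
move: Ibounds; set I := (\int[P]_u _)%E => /andP[I0 IM].
have Ifin : I \is a fin_num by rewrite ge0_fin_numE// (le_lt_trans IM)// ltry.
move: I0 IM; rewrite -(fineK Ifin) !lee_fin -/M -/l => I0 IM.
case: (travel_cost S Pw w 0 x) => [a||]//=; rewrite -?EFinB !lee_fin => a0.
have : 2 * M * r * r < t * r by rewrite ltr_pM2r.
rewrite -mulrA -expr2 r2; have : 0 < l * M by exact: mulr_gt0.
lra.
Qed.
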